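(* Consider the three-parameter family of differential equations $$x'=y,\qquad y'=z^2\sin x\cos x-\sin x-\varepsilon y,\qquad z'=\alpha(\cos x-\beta),$$ with $(\beta,\alpha,\varepsilon)\in(0,1)\times(0,\infty)\times(0,\infty)$, and its equilibrium $P_0=(\arccos\beta,0,\beta^{-1/2})$. On the critical surface $\{\varepsilon=\varepsilon_c:=2\alpha\beta^{3/2}\}$, parametrized by $(\beta,\alpha)\in(0,1)\times(0,\infty)$, let $l_1$ and $l_2$ be the first and second Lyapunov coefficients at $P_0$ (defined in the context). Then there is a unique point $Q=(\beta,\alpha,\varepsilon_c)$ of the critical surface at which the curves $l_1=0$ and $l_2=0$ intersect; its coordinates are $$\beta=0.86828033997971281542\ldots,\quad \alpha=0.85050048430685017856\ldots,\quad \varepsilon_c=1.37624106484659953171\ldots,$$ and at $Q$ the two curves intersect transversally.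
   Context: Write the system as $\mathbf{x}'=f(\mathbf{x},\mu)$ with $\mathbf{x}=(x,y,z)$, $x\in(0,\pi/2)$, $y\in\mathbb{R}$, $z\ge 0$, $\mu=(\beta,\alpha,\varepsilon)$. For $\varepsilon=\varepsilon_c=2\alpha\beta^{3/2}$ the Jacobian matrix $A$ of $f$ at $P_0$ has eigenvalues $-\varepsilon_c$ and $\pm i\omega_0$, where $\omega_0=\sqrt{(1-\beta^2)/\beta}$. Let $B,C,D,E$ be the symmetric multilinear maps given by the partial derivatives of $f(\cdot,\mu)$ of order $2,3,4,5$ at $P_0$, extended complex-multilinearly to $\mathbb{C}^3$, so that $f(P_0+\mathbf{x},\mu)=A\mathbf{x}+\frac12B(\mathbf{x},\mathbf{x})+\frac16C(\mathbf{x},\mathbf{x},\mathbf{x})+\frac1{24}D(\mathbf{x},\mathbf{x},\mathbf{x},\mathbf{x})+\frac1{120}E(\mathbf{x},\mathbf{x},\mathbf{x},\mathbf{x},\mathbf{x})+\cdots$. Let $I$ be the $3\times3$ identity matrix and $\langle u,v\rangle=\sum_i\bar u_iv_i$. Put $$q=\Bigl(-i,\ \omega_0,\ \frac{\varepsilon_c}{2\beta}\Bigr),\qquad p=\Bigl(-\frac i2,\ \frac{\omega_0-i\varepsilon_c}{2(\omega_0^2+\varepsilon_c^2)},\ \frac{\beta(\varepsilon_c+i\omega_0)}{\omega_0^2+\varepsilon_c^2}\Bigr),$$ which satisfy $Aq=i\omega_0q$, $A^{\top}p=-i\omega_0p$, $\langle p,q\rangle=1$. Define successively $h_{11}=-A^{-1}B(q,\bar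 q)$; $h_{20}=(2i\omega_0I-A)^{-1}B(q,q)$; $h_{30}=(3i\omega_0I-A)^{-1}[3B(q,h_{20})+C(q,q,q)]$; $G_{21}=\langle p,\ C(q,q,\bar q)+B(\bar q,h_{20})+2B(q,h_{11})\rangle$; $h_{21}$ = the unique solution of $(i\omega_0I-A)h_{21}=C(q,q,\bar q)+B(\bar q,h_{20})+2B(q,h_{11})-G_{21}q$ with $\langle p,h_{21}\rangle=0$; $h_{31}=(2i\omega_0I-A)^{-1}[3B(q,h_{21})+B(\bar q,h_{30})+3B(h_{20},h_{11})+3C(q,q,h_{11})+3C(q,\bar q,h_{20})+D(q,q,q,\bar q)-3G_{21}h_{20}]$; $h_{22}=-A^{-1}[D(q,q,\bar q,\bar q)+4C(q,\bar q,h_{11})+C(\bar q,\bar q,h_{20})+C(q,q,\bar h_{20})+2B(h_{11},h_{11})+2B(q,\bar h_{21})+2B(\bar q,h_{21})+B(\bar h_{20},h_{20})]$; $G_{32}=\langle p,\ 6B(h_{11},h_{21})+B(\bar h_{20},h_{30})+3B(\bar h_{21},h_{20})+3B(q,h_{22})+2B(\bar q,h_{31})+6C(q,h_{11},h_{11})+3C(q,\bar h_{20},h_{20})+3C(q,q,\bar h_{21})+6C(q,\bar q,h_{21})+6C(\bar q,h_{20},h_{11})+C(\bar q,\bar q,h_{30})+D(q,q,q,\bar h_{20})+6D(q,q,\bar q,h_{11})+3D(q,\bar q,\bar q,h_{20})+E(q,q,q,\bar q,\bar q)\rangle$. The first and second Lyapunov coefficients are $l_1=\frac12\operatorname{Re}G_{21}$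 and $l_2=\frac1{12}\operatorname{Re}G_{32}$, regarded as functions of $(\beta,\alpha)$ on the critical surface (in $h_{22}$ no term $-2h_{11}(G_{21}+\bar G_{21})$ is included, since it vanishes when $l_1=0$). Transversal intersection at $Q$ means that the gradients of $l_1$ and $l_2$ with respect to $(\beta,\alpha)$ at $Q$ are linearly independent. A decimal followed by ''$\ldots$'' displays the leading digits of the decimal expansion. *)

(* Defs.v *)
From HB Require Import structures.
From mathcomp Require Import all_boot all_order all_algebra.
From mathcomp Require Import complex.
From mathcomp Require Import all_classical all_reals all_analysis.

Set Implicit Arguments.
Unset Strict Implicit.
Unset Printing Implicit Defensive.

Import Order.TTheory GRing.Theory Num.Theory.
Import numFieldNormedType.Exports.

Local Open Scope classical_set_scope.
Local Open Scope ring_scope.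
Local Open Scope complex_scope.

Section Derivatives.
Variables (R : realType) (n : nat).
Implicit Types (g : 'cV[R]_n.+1 -> R) (x : 'cV[R]_n.+1).

Definition partial (j : 'I_n.+1) g : 'cV[R]_n.+1 -> R :=
  fun x => 'D_(delta_mx j 0) g x.

Definition gradient g x : 'rV[R]_n.+1 := \row_j partial j g x.

(* The form (u_1, ..., u_k) |-> \sum_(j_1, ..., j_k)
   (d^k g / dx_(j_1) ... dx_(j_k)) x * u_1 j_1 * ... * u_k j_k
   on complex vectors, with us = [:: u_1; ...; u_k]. *)
Fixpoint kth_diff g (us : seq 'cV[R[i]]_n.+1) x : R[i] :=
  if us is u :: us' then \sum_j u j 0 * kth_diff (partial j g) us' x
  else (g x)%:C.

End Derivatives.

Section Governor.
Variables (R : realType) (beta alpha eps : R).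

Definition vfield (X : 'cV[R]_3) : 'cV[R]_3 :=
  let x := X 0 0 in let y := X 1 0 in let z := X 2 0 in
  \col_i [:: y;
             z ^+ 2 * sin x * cos x - sin x - eps * y;
             alpha * (cos x - beta)]`_i.

Definition P0 : 'cV[R]_3 := \col_i [:: acos beta; 0; beta `^ (- 2^-1)]`_i.

Definition jac : 'M[R]_3 :=
  \matrix_(i, j) partial j (fun X => vfield X i 0) P0.

Definition vfield_diff (us : seq 'cV[R[i]]_3) : 'cV[R[i]]_3 :=
  \col_i kth_diff (fun X => vfield X i 0) us P0.

End Governor.

Section Lyapunov.
Variables (R : realType) (beta alpha : R).

Definition eps_c : R := 2 * alpha * beta `^ (3 / 2).
Definition omega0 : R := Num.sqrt ((1 - beta ^+ 2) / beta).

Local Notation vect := 'cV[R[i]]_3.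
Local Notation T := (vfield_diff beta alpha eps_c).

Definition B (u v : vect) : vect := T [:: u; v].
Definition C (u v w : vect) : vect := T [:: u; v; w].
Definition D (u v w s : vect) : vect := T [:: u; v; w; s].
Definition E (u v w s t : vect) : vect := T [:: u; v; w; s; t].

Definition A : 'M[R[i]]_3 := map_mx (real_complex R) (jac beta alpha eps_c).

Definition bar (u : vect) : vect := map_mx conjc u.

Definition inner (u v : vect) : R[i] := \sum_i ((u i 0)^*)%C * v i 0.

Definition iw : R[i] := 'i%C * omega0%:C.

Definition q : vect :=
  \col_i [:: - 'i%C; omega0%:C; (eps_c / (2 * beta))%:C]`_i.

Definition p : vect :=
  \col_i [:: - 'i%C / 2;
             (omega0%:C - 'i%C * eps_c%:C)
               / (2 * (omega0 ^+ 2 + eps_c ^+ 2))%:C;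
             beta%:C * (eps_c%:C + 'i%C * omega0%:C)
               / (omega0 ^+ 2 + eps_c ^+ 2)%:C]`_i.

Definition h11 : vect := - (invmx A *m B q (bar q)).

Definition h20 : vect := invmx ((2 * iw)%:M - A) *m B q q.

Definition h30 : vect :=
  invmx ((3 * iw)%:M - A) *m (3 *: B q h20 + C q q q).

Definition r21 : vect := C q q (bar q) + B (bar q) h20 + 2 *: B q h11.

Definition G21 : R[i] := inner p r21.

(* The system determines h21 uniquely; xget selects its solution. *)
Definition h21 : vect :=
  xget 0 [set h | (iw%:M - A) *m h = r21 - G21 *: q /\ inner p h = 0].

Definition h31 : vect :=
  invmx ((2 * iw)%:M - A) *m
    (3 *: B q h21 + B (bar q) h30 + 3 *: B h20 h11 + 3 *: C q q h11
     + 3 *: C q (bar q) h20 + D q q q (bar q) - (3 * G21) *: h20).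

Definition h22 : vect :=
  - (invmx A *m
    (D q q (bar q) (bar q) + 4 *: C q (bar q) h11 + C (bar q) (bar q) h20
     + C q q (bar h20) + 2 *: B h11 h11 + 2 *: B q (bar h21)
     + 2 *: B (bar q) h21 + B (bar h20) h20)).

Definition G32 : R[i] :=
  inner p
    (6 *: B h11 h21 + B (bar h20) h30 + 3 *: B (bar h21) h20 + 3 *: B q h22
     + 2 *: B (bar q) h31 + 6 *: C q h11 h11 + 3 *: C q (bar h20) h20
     + 3 *: C q q (bar h21) + 6 *: C q (bar q) h21 + 6 *: C (bar q) h20 h11
     + C (bar q) (bar q) h30 + D q q q (bar h20) + 6 *: D q q (bar q) h11
     + 3 *: D q (bar q) (bar q) h20 + E q q q (bar q) (bar q)).

Definition l1 : R := 2^-1 * complex.Re G21.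
Definition l2 : R := 12^-1 * complex.Re G32.

End Lyapunov.

Section Transversality.
Variable R : realType.

Definition on_plane (l : R -> R -> R) : 'cV[R]_2 -> R :=
  fun m => l (m 0 0) (m 1 0).

Definition transversal_at (f g : 'cV[R]_2 -> R) (m : 'cV[R]_2) : Prop :=
  [/\ differentiable f m, differentiable g m
    & row_free (col_mx (gradient f m) (gradient g m))].

End Transversality.

(* The decimal expansion of x >= 0 starts with  m . d_1 d_2 ... d_k,
   where ds = [:: d_1; ...; d_k] (truncation, not rounding). *)
Definition leading_digits (R : realType) (x : R) (m : nat) (ds : seq nat) :=
  let t := m%:R + \sum_(k < size ds) (nth 0%N ds k)%:R / 10 ^+ k.+1 : R in
  t <= x < t + (10 ^+ size ds)^-1.

(* Main.v *)
(* Write r = sqrt beta, s = sin x0 and sigma = 'i * s. After rescaling z by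
   1 / r, time by r, the amplitude of q by beta, and rotating x and y by 'i, the
   vectors h_jk become rational functions of sigma and e = alpha * beta ^+ 2,
   two independent variables; complex conjugation is sigma |-> - sigma. Hence
   the real parts of G21 and G32 are explicit: up to nonvanishing factors they
   are polynomials in S = beta ^+ 2 - 1 = sigma ^+ 2 and W = e ^+ 2. The first
   one vanishes exactly on the rational curve
   beta ^+ 2 = (3 + t) / (5 - t ^+ 2), W = t * beta ^+ 2 with 0 < t < 1, along
   which the second one is a nonvanishing factor times a polynomial of degree 10
   in t. By Descartes' rule in t / (1 - t) this polynomial has a single root,
   which is simple; simplicity makes the second coefficient cross zero
   transversally along the curve. *)
From HB Require Import structures.
Require Import Defs.
From mathcomp Require Import all_boot all_order all_algebra.
From mathcomp Require Import all_classical all_reals all_analysis.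
From mathcomp Require Import complex ring lra.
Import Order.TTheory GRing.Theory Num.Theory.
Import numFieldNormedType.Exports.
Local Open Scope ring_scope.

Set Implicit Arguments.
Unset Strict Implicit.
Unset Printing Implicit Defensive.

(** * Partial derivatives of polynomials of degree two in z *)

(** The defining formulas nest matrix inverses, complex conjugates and square roots. In the
    normalized coordinates the square roots survive only as overall powers of r, so each defining
    equation becomes a rational identity in s and e. Up to the factor 1/r the linear part has
    eigenvalues s, -s and -2e. The resolvents at 0, 2s, 3s and the pairing with [p] therefore create
    only the denominators s, e, e + s, 2e + 3s, 2e + s and their conjugates; none vanishes, since e
    is real and positive while s is imaginary and nonzero. The parameter of the rational curve is
    the slope t = W / beta^2 = (alpha beta)^2 of a line through a point of a conic. The gradient of
    l2 is never computed: along the curve, l2 is a factor times a polynomial in t, and at a simple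
    root of the polynomial the derivative of the factor drops out. *)

Section Coordinates.
Variables (R : realType) (n : nat).
Implicit Types (X v : 'cV[R]_n.+1).

Lemma is_derive_coord i X v :
  is_derive X v (fun Y : 'cV[R]_n.+1 => Y i 0) (v i 0).
Proof.
pose f : 'cV[R]_n.+1 -> R := fun Y => Y i 0.
have lf : linear f by move=> a u w; rewrite /f !mxE.
pose fm := GRing.isLinear.Build _ _ _ _ f lf.
pose fl : {linear 'cV[R]_n.+1 -> R} := HB.pack f fm.
have df : differentiable f X by exact: differentiable_coord.
apply: DeriveDef; first exact: diff_derivable.
rewrite deriveE // (_ : (fun _ => _) = fl) // diff_lin //.
exact: coord_continuous.
Qed.

Lemma is_derive_comp_fun (g : R -> R) (f : 'cV[R]_n.+1 -> R) X v dg df :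
  differentiable f X -> is_derive X v f df -> is_derive (f X) 1 g dg ->
  is_derive X v (fun Y => g (f Y)) (dg * df).
Proof.
move=> fX [_ <-] [gX <-].
have gd : differentiable g (f X) by exact/derivable1_diffP.
have gfX : differentiable (g \o f) X by exact: differentiable_comp.
apply: DeriveDef; first exact: diff_derivable.
rewrite (_ : (fun _ => _) = g \o f) // deriveE // diff_comp //=.
by rewrite diff1E // -deriveE // derive1E mulrC.
Qed.

End Coordinates.

Section QuadraticInZ.
Variable R : realType.
Implicit Types (g : nat -> R -> R) (X : 'cV[R]_3) (e : R).

(** With [g k] as the k-th derivative of [g 0], differentiating in x is a shift of the index. *)
Definition derivative_tower g :=
  forall (k : nat) (x : R), is_derive x 1 (g k) (g k.+1 x).

(** The class contains the three components of the vector field and is closed under partial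
    derivatives, so differentials of every order can be computed inside it. *)
Definition zquad g2 g1 g0 e X : R :=
  X 2 0 ^+ 2 * g2 0%N (X 0 0) + X 2 0 * g1 0%N (X 0 0) + g0 0%N (X 0 0)
  + e * X 1 0.

Definition next_tower g : nat -> R -> R := fun k => g k.+1.
Definition tower0 : nat -> R -> R := fun _ _ => 0.
Definition tower_cst e : nat -> R -> R := fun k _ => if k is 0%N then e else 0.
Definition twice_tower g : nat -> R -> R := fun k x => 2 * g k x.

Lemma tower_next g : derivative_tower g -> derivative_tower (next_tower g).
Proof. by move=> gt k x; exact: gt. Qed.

Lemma tower_tower0 : derivative_tower tower0.
Proof. by move=> k x; exact: is_derive_cst. Qed.

Lemma tower_tower_cst e : derivative_tower (tower_cst e).
Proof. by move=> [|k] x; exact: is_derive_cst. Qed.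

Lemma tower_twice g : derivative_tower g -> derivative_tower (twice_tower g).
Proof.
move=> gt k x; have gk := gt k x.
exact: (@is_deriveZ _ _ _ (g k) 2 x 1 _ gk).
Qed.

Lemma is_derive_zquad g2 g1 g0 e X v : derivative_tower g2 ->
  derivative_tower g1 -> derivative_tower g0 ->
  is_derive X v (zquad g2 g1 g0 e)
    (v 0 0 * (X 2 0 ^+ 2 * g2 1%N (X 0 0) + X 2 0 * g1 1%N (X 0 0)
              + g0 1%N (X 0 0))
     + e * v 1 0
     + v 2 0 * (2 * X 2 0 * g2 0%N (X 0 0) + g1 0%N (X 0 0))).
Proof.
move=> t2 t1 t0.
have dc i := is_derive_coord i X v.
have dg g : derivative_tower g ->
    is_derive X v (fun Y : 'cV[R]_3 => g 0%N (Y 0 0)) (g 1%N (X 0 0) * v 0 0).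
  move=> gt; exact: (@is_derive_comp_fun R 2 (g 0%N) (fun Y => Y 0 0) X v _ _
    (differentiable_coord X 0 0) (dc 0) (gt 0%N (X 0 0))).
have d2 := dg _ t2; have d1 := dg _ t1; have d0 := dg _ t0.
have dz := dc 2; have dy := dc 1.
have H := is_deriveD (is_deriveD (is_deriveD (is_deriveM (is_deriveX 2 dz) d2)
  (is_deriveM dz d1)) d0) (is_deriveZ e dy).
by apply: (is_derive_eq H); rewrite /GRing.scale /= exprfctE /=; ring.
Qed.

Lemma partial_zquad g2 g1 g0 e : derivative_tower g2 -> derivative_tower g1 ->
  derivative_tower g0 ->
  [/\ partial 0 (zquad g2 g1 g0 e) =
        zquad (next_tower g2) (next_tower g1) (next_tower g0) 0,
      partial 1 (zquad g2 g1 g0 e) = zquad tower0 tower0 (tower_cst e) 0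
    & partial 2 (zquad g2 g1 g0 e) = zquad tower0 (twice_tower g2) g1 0].
Proof.
move=> t2 t1 t0.
have pE j X : partial j (zquad g2 g1 g0 e) X = _ :=
  @derive_val _ _ _ _ _ _ _ (is_derive_zquad e X (delta_mx j 0) t2 t1 t0).
split; apply/funext => X; rewrite pE !mxE /=;
  rewrite /zquad /next_tower /tower0 /twice_tower /=; ring.
Qed.

Lemma sum3 (V : nmodType) (F : 'I_3 -> V) : \sum_i F i = F 0 + F 1 + F 2.
Proof.
rewrite !big_ord_recr big_ord0 /= add0r.
by congr (F _ + F _ + F _); apply: val_inj.
Qed.

Lemma kth_diff_cons g2 g1 g0 e u us X : derivative_tower g2 ->
  derivative_tower g1 -> derivative_tower g0 ->
  kth_diff (zquad g2 g1 g0 e) (u :: us) X =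
    u 0 0 * kth_diff (zquad (next_tower g2) (next_tower g1) (next_tower g0) 0)
      us X
    + u 1 0 * kth_diff (zquad tower0 tower0 (tower_cst e) 0) us X
    + u 2 0 * kth_diff (zquad tower0 (twice_tower g2) g1 0) us X.
Proof.
move=> t2 t1 t0; have [p0 p1 p2] := partial_zquad e t2 t1 t0.
by rewrite [LHS]sum3 p0 p1 p2.
Qed.

Lemma kth_diff_tower0 us X :
  kth_diff (zquad tower0 tower0 tower0 0) us X = 0.
Proof.
have t0 := tower_tower0.
elim: us X => [|u us IH] X.
  by rewrite /= /zquad /tower0 !(mulr0, mul0r, addr0).
rewrite kth_diff_cons // (_ : tower_cst 0 = tower0); last first.
  by apply/funext => -[].
rewrite (_ : next_tower _ = tower0) // (_ : twice_tower _ = tower0); last first.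
  by apply/funext => k; apply/funext => x; rewrite /twice_tower mulr0.
by rewrite !IH !mulr0 !addr0.
Qed.

Lemma kth_diff_cst e u us X :
  kth_diff (zquad tower0 tower0 (tower_cst e) 0) (u :: us) X = 0.
Proof.
have t0 := tower_tower0; have te := tower_tower_cst e.
rewrite kth_diff_cons // (_ : tower_cst 0 = tower0); last first.
  by apply/funext => -[].
rewrite (_ : next_tower (tower_cst e) = tower0) //.
rewrite (_ : next_tower _ = tower0) // (_ : twice_tower _ = tower0); last first.
  by apply/funext => k; apply/funext => x; rewrite /twice_tower mulr0.
by rewrite !kth_diff_tower0 !mulr0 !addr0.
Qed.

(** The derivative in y is a constant, so its own differentials vanish: from order two on only the
    directions x and z contribute. *)
Lemma kth_diff_cons2 g2 g1 g0 e u v us X : derivative_tower g2 ->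
  derivative_tower g1 -> derivative_tower g0 ->
  kth_diff (zquad g2 g1 g0 e) (u :: v :: us) X =
    u 0 0 * kth_diff (zquad (next_tower g2) (next_tower g1) (next_tower g0) 0)
      (v :: us) X
    + u 2 0 * kth_diff (zquad tower0 (twice_tower g2) g1 0) (v :: us) X.
Proof.
by move=> t2 t1 t0; rewrite kth_diff_cons // kth_diff_cst mulr0 addr0.
Qed.

End QuadraticInZ.

(** * Differentials of orders two to five *)

Section MultilinearForms.
Variables (R : realType) (g2 g1 g0 : nat -> R -> R) (e : R).
Hypotheses (t2 : derivative_tower g2) (t1 : derivative_tower g1).
Hypothesis t0 : derivative_tower g0.
Variable X : 'cV[R]_3.
Implicit Types u v w s t : 'cV[R[i]]_3.
Local Open Scope complex_scope.

(** For k > 0, [Dx k], [Dz k] and [Dzz k] are the derivatives of [zquad] of order k in x and of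
    order 0, 1, 2 in z. All other derivatives of order at least two are zero. *)
Let Dx k : R[i] :=
  (X 2 0 ^+ 2 * g2 k (X 0 0) + X 2 0 * g1 k (X 0 0) + g0 k (X 0 0))%:C.
Let Dz k : R[i] := (2 * X 2 0 * g2 k (X 0 0) + g1 k (X 0 0))%:C.
Let Dzz k : R[i] := (2 * g2 k (X 0 0))%:C.
Local Notation f := (zquad g2 g1 g0 e).

Ltac expand_kth_diff :=
  repeat first [rewrite kth_diff_cons2 | rewrite kth_diff_cons];
  try solve [auto 10 using tower_next, tower_twice, tower_tower0];
  rewrite /Dx /Dz /Dzz /= /zquad /next_tower /twice_tower /tower0 /=;
  ring.

Lemma kth_diff2 u v : kth_diff f [:: u; v] X =
  Dx 2 * u 0 0 * v 0 0 + Dz 1 * (u 0 0 * v 2 0 + u 2 0 * v 0 0)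
  + Dzz 0 * u 2 0 * v 2 0.
Proof. by expand_kth_diff. Qed.

Lemma kth_diff3 u v w : kth_diff f [:: u; v; w] X =
  Dx 3 * u 0 0 * v 0 0 * w 0 0
  + Dz 2 * (u 2 0 * v 0 0 * w 0 0 + u 0 0 * v 2 0 * w 0 0
            + u 0 0 * v 0 0 * w 2 0)
  + Dzz 1 * (u 0 0 * v 2 0 * w 2 0 + u 2 0 * v 0 0 * w 2 0
             + u 2 0 * v 2 0 * w 0 0).
Proof. by expand_kth_diff. Qed.

Lemma kth_diff4 u v w s : kth_diff f [:: u; v; w; s] X =
  Dx 4 * u 0 0 * v 0 0 * w 0 0 * s 0 0
  + Dz 3 * (u 2 0 * v 0 0 * w 0 0 * s 0 0 + u 0 0 * v 2 0 * w 0 0 * s 0 0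
            + u 0 0 * v 0 0 * w 2 0 * s 0 0 + u 0 0 * v 0 0 * w 0 0 * s 2 0)
  + Dzz 2 * (u 2 0 * v 2 0 * w 0 0 * s 0 0 + u 2 0 * v 0 0 * w 2 0 * s 0 0
             + u 2 0 * v 0 0 * w 0 0 * s 2 0 + u 0 0 * v 2 0 * w 2 0 * s 0 0
             + u 0 0 * v 2 0 * w 0 0 * s 2 0 + u 0 0 * v 0 0 * w 2 0 * s 2 0).
Proof. by expand_kth_diff. Qed.

Lemma kth_diff5 u v w s t : kth_diff f [:: u; v; w; s; t] X =
  Dx 5 * u 0 0 * v 0 0 * w 0 0 * s 0 0 * t 0 0
  + Dz 4 * (u 2 0 * v 0 0 * w 0 0 * s 0 0 * t 0 0
            + u 0 0 * v 2 0 * w 0 0 * s 0 0 * t 0 0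
            + u 0 0 * v 0 0 * w 2 0 * s 0 0 * t 0 0
            + u 0 0 * v 0 0 * w 0 0 * s 2 0 * t 0 0
            + u 0 0 * v 0 0 * w 0 0 * s 0 0 * t 2 0)
  + Dzz 3 * (u 0 0 * v 0 0 * w 0 0 * s 2 0 * t 2 0
             + u 0 0 * v 0 0 * w 2 0 * s 0 0 * t 2 0
             + u 0 0 * v 2 0 * w 0 0 * s 0 0 * t 2 0
             + u 2 0 * v 0 0 * w 0 0 * s 0 0 * t 2 0
             + u 0 0 * v 0 0 * w 2 0 * s 2 0 * t 0 0
             + u 0 0 * v 2 0 * w 0 0 * s 2 0 * t 0 0
             + u 2 0 * v 0 0 * w 0 0 * s 2 0 * t 0 0
             + u 0 0 * v 2 0 * w 2 0 * s 0 0 * t 0 0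
             + u 2 0 * v 0 0 * w 2 0 * s 0 0 * t 0 0
             + u 2 0 * v 2 0 * w 0 0 * s 0 0 * t 0 0).
Proof. by expand_kth_diff. Qed.

End MultilinearForms.

(** * Rational normal form coefficients *)

Section LyapunovPolynomials.
Variable K : comNzRingType.

Definition bautin_poly (S W : K) : K := W ^+ 2 + W - 5 * S ^+ 2 - 7 * S - 2.

(* Numerals denote unary natural numbers, so that large coefficients are written
   in base 1000. *)
Definition second_poly (S W : K) : K :=
  640 * S * W ^+ 8
  + (- (7 * 1000 + 248) * S ^+ 2 - (3 * 1000 + 8) * S - 640) * W ^+ 7
  + ((25 * 1000 + 648) * S ^+ 3 + (18 * 1000 + 656) * S ^+ 2 + (6 * 1000 +
  784) * S - 640) * W ^+ 6
  + ((33 * 1000 + 671) * S ^+ 4 + (116 * 1000 + 772) * S ^+ 3 + (87 * 1000 +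
  944) * S ^+ 2 + (27 * 1000 + 328) * S + (1000 + 280)) * W ^+ 5
  + (- (193 * 1000 + 734) * S ^+ 5 - 451 * 1000 * S ^+ 4 - (349 * 1000 + 124)
  * S ^+ 3 - (122 * 1000 + 856) * S ^+ 2 - (14 * 1000 + 976) * S) * W ^+ 4
  + ((173 * 1000 + 774) * S ^+ 6 + (389 * 1000 + 284) * S ^+ 5 + (330 * 1000
  + 641) * S ^+ 4 + (146 * 1000 + 344) * S ^+ 3 + (25 * 1000 + 680) * S ^+ 2)
  * W ^+ 3
  + ((2 * 1000 + 52) * S ^+ 7 + (23 * 1000 + 904) * S ^+ 6 + (9 * 1000 + 940)
  * S ^+ 5 - (21 * 1000 + 700) * S ^+ 4 - (9 * 1000 + 248) * S ^+ 3) * W ^+ 2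
  + (- (25 * 1000 + 29) * S ^+ 8 - (64 * 1000 + 476) * S ^+ 7 - (51 * 1000 +
  795) * S ^+ 6 - (12 * 1000 + 276) * S ^+ 5 + 72 * S ^+ 4) * W
  + (- (1000 + 134) * S ^+ 9 - (4 * 1000 + 212) * S ^+ 8 - (5 * 1000 + 670) *
  S ^+ 7 - (3 * 1000 + 240) * S ^+ 6 - 648 * S ^+ 5).

End LyapunovPolynomials.

Section NormalizedForms.
Variables (K : fieldType) (s e : K).
(** At s = sigma, b is beta^2 and c = 2 beta^2 - 1 is the cosine of twice the angle at the
    equilibrium. The forms below return the v and w components only. *)
Let b := 1 + s ^+ 2.
Let c := 1 + 2 * s ^+ 2.

Definition form2 (x w x' w' : K) : K * K :=
  (- 3 * s * b * x * x' + 2 * c * (x * w' + w * x') - 2 * s * w * w',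
   e * b * x * x').

Definition form3 (x1 w1 x2 w2 x3 w3 : K) : K * K :=
  ((4 * c - b) * b * x1 * x2 * x3
   - 8 * s * b * (w1 * x2 * x3 + x1 * w2 * x3 + x1 * x2 * w3)
   + 2 * c * (x1 * w2 * w3 + w1 * x2 * w3 + w1 * w2 * x3),
   - e * s * b * x1 * x2 * x3).

Definition form4 (x1 w1 x2 w2 x3 w3 x4 w4 : K) : K * K :=
  (- 15 * s * b ^+ 2 * x1 * x2 * x3 * x4
   + 8 * c * b * (w1 * x2 * x3 * x4 + x1 * w2 * x3 * x4
                  + x1 * x2 * w3 * x4 + x1 * x2 * x3 * w4)
   - 8 * s * b * (w1 * w2 * x3 * x4 + w1 * x2 * w3 * x4 + w1 * x2 * x3 * w4
                  + x1 * w2 * w3 * x4 + x1 * w2 * x3 * w4 + x1 * x2 * w3 * w4),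
   e * b ^+ 2 * x1 * x2 * x3 * x4).

Definition form5 (x1 w1 x2 w2 x3 w3 x4 w4 x5 w5 : K) : K * K :=
  ((16 * c - b) * b ^+ 2 * x1 * x2 * x3 * x4 * x5
   - 32 * s * b ^+ 2 * (w1 * x2 * x3 * x4 * x5 + x1 * w2 * x3 * x4 * x5
        + x1 * x2 * w3 * x4 * x5 + x1 * x2 * x3 * w4 * x5
        + x1 * x2 * x3 * x4 * w5)
   + 8 * c * b * (x1 * x2 * x3 * w4 * w5 + x1 * x2 * w3 * x4 * w5
        + x1 * w2 * x3 * x4 * w5 + w1 * x2 * x3 * x4 * w5
        + x1 * x2 * w3 * w4 * x5 + x1 * w2 * x3 * w4 * x5
        + w1 * x2 * x3 * w4 * x5 + x1 * w2 * w3 * x4 * x5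
        + w1 * x2 * w3 * x4 * x5 + w1 * w2 * x3 * x4 * x5),
   - e * s * b ^+ 2 * x1 * x2 * x3 * x4 * x5).

End NormalizedForms.

(* The x and w coordinates of the h_jk, and G21, G32, in normalized coordinates,
   found by solving the defining linear systems over the rational functions in
   s = sigma and e; the v coordinate never enters the multilinear forms. *)
Section Coefficients.
Variables (K : fieldType) (s e : K).

Definition h11x : K :=
  (- s ^+ 2 - 1)
  / s.

Definition h11w : K :=
  - e ^+ 2
  + (s ^+ 2 + 1).

Definition h20x : K :=
  ((- 2 * s) * e ^+ 2
   + (- 9 * s ^+ 2 - 5) * e
   + (- 3 * s ^+ 3 - 3 * s))
  / (3 * s * (e + s)).

Definition h20w : K :=
  (s * e ^+ 3
   + (6 * s ^+ 2 + 4) * e ^+ 2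
   + (3 * s ^+ 3 + 3 * s) * e)
  / (3 * s * (e + s)).

Definition h30x : K :=
  ((- 3 * s ^+ 2) * e ^+ 4
   + (- 56 * s ^+ 3 - 32 * s) * e ^+ 3
   + (- 172 * s ^+ 4 - 177 * s ^+ 2 - 32) * e ^+ 2
   + (- 127 * s ^+ 5 - 175 * s ^+ 3 - 48 * s) * e
   + (- 24 * s ^+ 6 - 42 * s ^+ 4 - 18 * s ^+ 2))
  / (4 * s ^+ 2 * (e + s) * (2 * e + 3 * s)).

Definition h30w : K :=
  (s ^+ 2 * e ^+ 5
   + (24 * s ^+ 3 + 16 * s) * e ^+ 4
   + (92 * s ^+ 4 + 107 * s ^+ 2 + 24) * e ^+ 3
   + (93 * s ^+ 5 + 137 * s ^+ 3 + 44 * s) * e ^+ 2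
   + (24 * s ^+ 6 + 42 * s ^+ 4 + 18 * s ^+ 2) * e)
  / (4 * s ^+ 2 * (e + s) * (2 * e + 3 * s)).

Definition g21 : K :=
  ((- 5 * s ^+ 2) * e ^+ 4
   + (- 6 * s ^+ 3) * e ^+ 3
   + (9 * s ^+ 2 + 8) * e ^+ 2
   + (3 * s ^+ 5 + 15 * s ^+ 3 + 12 * s) * e
   + (6 * s ^+ 6 + 12 * s ^+ 4 + 6 * s ^+ 2))
  / (3 * s * (e + s) * (2 * e + s)).

Definition h21x : K :=
  (10 * s ^+ 2 * e ^+ 5
   + (- s ^+ 3 - 8 * s) * e ^+ 4
   + (- 34 * s ^+ 4 - 42 * s ^+ 2 - 12) * e ^+ 3
   + (- 18 * s ^+ 5 - 19 * s ^+ 3 - 2 * s) * e ^+ 2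
   + (- 9 * s ^+ 6 - 3 * s ^+ 4 + 6 * s ^+ 2) * e
   + (6 * s ^+ 7 + 12 * s ^+ 5 + 6 * s ^+ 3))
  / (6 * s ^+ 2 * (e + s) * (2 * e + s) ^+ 2).

Definition h21w : K :=
  (10 * s ^+ 2 * e ^+ 6
   + (19 * s ^+ 3 - 8 * s) * e ^+ 5
   + (- 18 * s ^+ 4 - 50 * s ^+ 2 - 12) * e ^+ 4
   + (- 46 * s ^+ 5 - 79 * s ^+ 3 - 30 * s) * e ^+ 3
   + (- 33 * s ^+ 6 - 61 * s ^+ 4 - 28 * s ^+ 2) * e ^+ 2
   + (- 18 * s ^+ 7 - 30 * s ^+ 5 - 12 * s ^+ 3) * e)
  / (6 * s ^+ 2 * (e + s) * (2 * e + s) ^+ 2).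

Definition h31x : K :=
  ((- 472 * s ^+ 3) * e ^+ 9
   + (- (1000 + 332) * s ^+ 4 + 716 * s ^+ 2) * e ^+ 8
   + (- (1000 + 562) * s ^+ 5 + (1000 + 668) * s ^+ 3 - 704 * s) * e ^+ 7
   + (- (2 * 1000 + 295) * s ^+ 6 - (1000 + 493) * s ^+ 4 - (3 * 1000 + 36) *
   s ^+ 2 + 592) * e ^+ 6
   + (- (3 * 1000 + 420) * s ^+ 7 - (4 * 1000 + 842) * s ^+ 5 + 560 * s ^+ 3 +
   (4 * 1000 + 800) * s) * e ^+ 5
   + (- (3 * 1000 + 897) * s ^+ 8 - 366 * s ^+ 6 + (15 * 1000 + 801) * s ^+ 4
   + (13 * 1000 + 28) * s ^+ 2) * e ^+ 4
   + (- (2 * 1000 + 103) * s ^+ 9 + (9 * 1000 + 60) * s ^+ 7 + (28 * 1000 +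
   527) * s ^+ 5 + (17 * 1000 + 376) * s ^+ 3) * e ^+ 3
   + ((1000 + 404) * s ^+ 10 + (13 * 1000 + 413) * s ^+ 8 + (24 * 1000 + 747)
   * s ^+ 6 + (12 * 1000 + 738) * s ^+ 4) * e ^+ 2
   + ((1000 + 665) * s ^+ 11 + (7 * 1000 + 650) * s ^+ 9 + (10 * 1000 + 953) *
   s ^+ 7 + (4 * 1000 + 968) * s ^+ 5) * e
   + (324 * s ^+ 12 + (1000 + 458) * s ^+ 10 + (1000 + 944) * s ^+ 8 + 810 * s
   ^+ 6))
  / (36 * s ^+ 3 * (e + s) ^+ 3 * (2 * e + s) ^+ 2 * (2 * e + 3 * s)).

Definition h31w : K :=
  (356 * s ^+ 3 * e ^+ 10
   + ((1000 + 656) * s ^+ 4 - 112 * s ^+ 2) * e ^+ 9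
   + ((3 * 1000 + 145) * s ^+ 5 - 600 * s ^+ 3 + 16 * s) * e ^+ 8
   + ((1000 + 593) * s ^+ 6 - (3 * 1000 + 824) * s ^+ 4 - (1000 + 776) * s ^+
   2 - 704) * e ^+ 7
   + (- (4 * 1000 + 851) * s ^+ 7 - (14 * 1000 + 310) * s ^+ 5 - (11 * 1000 +
   320) * s ^+ 3 - (4 * 1000 + 560) * s) * e ^+ 6
   + (- (10 * 1000 + 530) * s ^+ 8 - (27 * 1000 + 555) * s ^+ 6 - (27 * 1000 +
   912) * s ^+ 4 - (11 * 1000 + 632) * s ^+ 2) * e ^+ 5
   + (- (10 * 1000 + 815) * s ^+ 9 - (32 * 1000 + 286) * s ^+ 7 - (36 * 1000 +
   921) * s ^+ 5 - (15 * 1000 + 492) * s ^+ 3) * e ^+ 4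
   + (- (7 * 1000 + 695) * s ^+ 10 - (24 * 1000 + 675) * s ^+ 8 - (28 * 1000 +
   596) * s ^+ 6 - (11 * 1000 + 616) * s ^+ 4) * e ^+ 3
   + (- (3 * 1000 + 411) * s ^+ 11 - (10 * 1000 + 980) * s ^+ 9 - (12 * 1000 +
   267) * s ^+ 7 - (4 * 1000 + 698) * s ^+ 5) * e ^+ 2
   + (- 648 * s ^+ 12 - (2 * 1000 + 106) * s ^+ 10 - (2 * 1000 + 268) * s ^+ 8
   - 810 * s ^+ 6) * e)
  / (36 * s ^+ 3 * (e + s) ^+ 3 * (2 * e + s) ^+ 2 * (2 * e + 3 * s)).

Definition h22x : K :=
  ((176 * s ^+ 4 + 176 * s ^+ 2) * e ^+ 8
   + ((1000 + 196) * s ^+ 6 + (2 * 1000 + 444) * s ^+ 4 + (1000 + 648) * s ^+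
   2 + 400) * e ^+ 6
   + (- (1000 + 474) * s ^+ 8 - (3 * 1000 + 502) * s ^+ 6 - (2 * 1000 + 924) *
   s ^+ 4 - 896 * s ^+ 2) * e ^+ 4
   + (- 204 * s ^+ 10 - 279 * s ^+ 8 + 88 * s ^+ 6 + 163 * s ^+ 4) * e ^+ 2
   + (- 54 * s ^+ 12 - 171 * s ^+ 10 - 180 * s ^+ 8 - 63 * s ^+ 6))
  / (9 * s ^+ 3 * (e + s) * (e - s) * (2 * e + s) ^+ 2 * (2 * e - s) ^+ 2).

Definition h22w : K :=
  ((- 544 * s ^+ 2) * e ^+ 10
   + ((2 * 1000 + 76) * s ^+ 4 + (1000 + 744) * s ^+ 2 + 544) * e ^+ 8
   + (- (4 * 1000 + 641) * s ^+ 6 - (6 * 1000 + 932) * s ^+ 4 - (3 * 1000 +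
   144) * s ^+ 2 - 544) * e ^+ 6
   + ((3 * 1000 + 304) * s ^+ 8 + (6 * 1000 + 664) * s ^+ 6 + (4 * 1000 + 764)
   * s ^+ 4 + (1000 + 400) * s ^+ 2) * e ^+ 4
   + (- 105 * s ^+ 10 - 252 * s ^+ 8 - 463 * s ^+ 6 - 316 * s ^+ 4) * e ^+ 2
   + (18 * s ^+ 12 + 108 * s ^+ 10 + 162 * s ^+ 8 + 72 * s ^+ 6))
  / (9 * s ^+ 2 * (e + s) * (e - s) * (2 * e + s) ^+ 2 * (2 * e - s) ^+ 2).

Definition g32 : K :=
  ((- (12 * 1000 + 560) * s ^+ 4) * e ^+ 14
   + (- (48 * 1000 + 320) * s ^+ 5) * e ^+ 13
   + (- (12 * 1000 + 920) * s ^+ 6 + (32 * 1000 + 928) * s ^+ 4 + (1000 + 408)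
   * s ^+ 2) * e ^+ 12
   + ((160 * 1000 + 456) * s ^+ 7 + (122 * 1000 + 688) * s ^+ 5 + (3 * 1000 +
   712) * s ^+ 3) * e ^+ 11
   + ((181 * 1000 + 123) * s ^+ 8 + (41 * 1000 + 808) * s ^+ 6 - (102 * 1000 +
   224) * s ^+ 4 - (60 * 1000 + 288) * s ^+ 2 - (14 * 1000 + 336)) * e ^+ 10
   + (- (130 * 1000 + 166) * s ^+ 9 - (367 * 1000 + 8) * s ^+ 7 - (404 * 1000
   + 960) * s ^+ 5 - (243 * 1000 + 72) * s ^+ 3 - (57 * 1000 + 344) * s) * e
   ^+ 9
   + (- (412 * 1000 + 389) * s ^+ 10 - (722 * 1000 + 454) * s ^+ 8 - (557 *
   1000 + 24) * s ^+ 6 - (275 * 1000 + 520) * s ^+ 4 - (54 * 1000 + 272) * s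
   ^+ 2) * e ^+ 8
   + (- (286 * 1000 + 500) * s ^+ 11 - (374 * 1000 + 892) * s ^+ 9 + (3 * 1000
   + 688) * s ^+ 7 + (166 * 1000 + 560) * s ^+ 5 + (66 * 1000 + 304) * s ^+ 3)
   * e ^+ 7
   + ((127 * 1000 + 632) * s ^+ 12 + (526 * 1000 + 326) * s ^+ 10 + (880 *
   1000 + 935) * s ^+ 8 + (651 * 1000 + 480) * s ^+ 6 + (170 * 1000 + 944) * s
   ^+ 4) * e ^+ 6
   + ((230 * 1000 + 964) * s ^+ 13 + (654 * 1000 + 600) * s ^+ 11 + (809 *
   1000 + 298) * s ^+ 9 + (497 * 1000 + 616) * s ^+ 7 + (110 * 1000 + 656) * s
   ^+ 5) * e ^+ 5
   + ((38 * 1000 + 421) * s ^+ 14 + (132 * 1000 + 678) * s ^+ 12 + (158 * 1000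
   + 424) * s ^+ 10 + (63 * 1000 + 372) * s ^+ 8 - (1000 + 536) * s ^+ 6) * e
   ^+ 4
   + ((8 * 1000 + 550) * s ^+ 15 + (57 * 1000 + 924) * s ^+ 13 + (52 * 1000 +
   662) * s ^+ 11 - (13 * 1000 + 512) * s ^+ 9 - (16 * 1000 + 800) * s ^+ 7) *
   e ^+ 3
   + ((20 * 1000 + 61) * s ^+ 16 + (73 * 1000 + 818) * s ^+ 14 + (88 * 1000 +
   173) * s ^+ 12 + (41 * 1000 + 292) * s ^+ 10 + (6 * 1000 + 876) * s ^+ 8) *
   e ^+ 2
   + (- (1000 + 512) * s ^+ 17 + (7 * 1000 + 344) * s ^+ 15 + (27 * 1000 +
   216) * s ^+ 13 + (26 * 1000 + 352) * s ^+ 11 + (7 * 1000 + 992) * s ^+ 9) *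
   e
   + (648 * s ^+ 18 + (5 * 1000 + 184) * s ^+ 16 + (10 * 1000 + 692) * s ^+ 14
   + (8 * 1000 + 424) * s ^+ 12 + (2 * 1000 + 268) * s ^+ 10))
  / (36 * s ^+ 3 * (e + s) ^+ 3 * (e - s) * (2 * e + s) ^+ 3 * (2 * e - s) ^+
  2 * (2 * e + 3 * s)).

End Coefficients.

Section CoefficientMorphisms.
Variables (K L : fieldType) (f : {rmorphism K -> L}) (s e : K).

Ltac push_morphism := rewrite fmorph_div; congr (_ / _); ring.

(** Rational expressions with integer coefficients commute with field morphisms. Applied to
    conjugation, which fixes e and negates s, this turns the conjugate of a coefficient into its
    value at -s. *)
Lemma rmorph_h20x : f (h20x s e) = h20x (f s) (f e).
Proof. by rewrite /h20x; push_morphism. Qed.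

Lemma rmorph_h20w : f (h20w s e) = h20w (f s) (f e).
Proof. by rewrite /h20w; push_morphism. Qed.

Lemma rmorph_h21x : f (h21x s e) = h21x (f s) (f e).
Proof. by rewrite /h21x; push_morphism. Qed.

Lemma rmorph_h21w : f (h21w s e) = h21w (f s) (f e).
Proof. by rewrite /h21w; push_morphism. Qed.

Lemma rmorph_g21 : f (g21 s e) = g21 (f s) (f e).
Proof. by rewrite /g21; push_morphism. Qed.

Lemma rmorph_g32 : f (g32 s e) = g32 (f s) (f e).
Proof. by rewrite /g32; push_morphism. Qed.

End CoefficientMorphisms.

(** * The defining linear systems as rational identities *)

Section CoefficientEquations.
Variables (K : numFieldType) (s e : K).
Hypotheses (s0 : s != 0) (e0 : e != 0) (e1p : e + s != 0) (e1m : e - s != 0).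
Hypotheses (e2p : 2 * e + s != 0) (e2m : 2 * e - s != 0).
Hypotheses (e3p : 2 * e + 3 * s != 0) (e3m : 2 * e - 3 * s != 0).

Local Notation X11 := (h11x s). Local Notation W11 := (h11w s e).
Local Notation X20 := (h20x s e). Local Notation W20 := (h20w s e).
Local Notation X20' := (- h20x (- s) e). Local Notation W20' := (h20w (- s) e).
Local Notation X30 := (h30x s e). Local Notation W30 := (h30w s e).
Local Notation X21 := (h21x s e). Local Notation W21 := (h21w s e).
Local Notation X21' := (- h21x (- s) e). Local Notation W21' := (h21w (- s) e).
Local Notation X31 := (h31x s e). Local Notation W31 := (h31w s e).
Local Notation X22 := (h22x s e). Local Notation W22 := (h22w s e).
Local Notation B := (form2 s e). Local Notation C := (form3 s e).
Local Notation D := (form4 s e). Local Notation E := (form5 s e).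

Ltac clear_denominators :=
  cbv beta iota zeta delta [form2 form3 form4 form5 fst snd
    h11x h11w h20x h20w h30x h30w g21 h21x h21w h31x h31w h22x h22w g32];
  field; rewrite ?pnatr_eq0 /= ?s0 ?e0 ?e1p ?e1m ?e2p ?e2m ?e3p ?e3m.

(** Each pair of lemmas in [_v] and [_w] gives the v and w rows of the system defining one h_jk. The
    x row only determines the v coordinate, which has already been substituted; here it is 0. *)
Lemma h11_v :
  - s ^+ 2 * X11 + 2 * s * W11 =
    (B (-1) e 1 e).1.
Proof. by clear_denominators. Qed.

Lemma h11_w :
  e * s * X11 = (B (-1) e 1 e).2.
Proof. by clear_denominators. Qed.

Lemma h20_v :
  2 * s * (2 * s * X20) - s ^+ 2 * X20 + 2 * e * (2 * s * X20) + 2 * s * W20 =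
    (B (-1) e (-1) e).1.
Proof. by clear_denominators. Qed.

Lemma h20_w :
  2 * s * W20 + e * s * X20 =
    (B (-1) e (-1) e).2.
Proof. by clear_denominators. Qed.

Lemma h30_v :
  3 * s * (3 * s * X30) - s ^+ 2 * X30 + 2 * e * (3 * s * X30) + 2 * s * W30 =
    3 * (B (-1) e X20 W20).1
    + (C (-1) e (-1) e (-1) e).1.
Proof. by clear_denominators. Qed.

Lemma h30_w :
  3 * s * W30 + e * s * X30 =
    3 * (B (-1) e X20 W20).2
    + (C (-1) e (-1) e (-1) e).2.
Proof. by clear_denominators. Qed.

Lemma g21_def :
  g21 s e =
    - (((C (-1) e (-1) e 1 e).1
    + (B 1 e X20 W20).1
    + 2 * (B (-1) e X11 W11).1) / 2
     - ((C (-1) e (-1) e 1 e).2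
    + (B 1 e X20 W20).2
    + 2 * (B (-1) e X11 W11).2)) / (2 * e + s).
Proof. by clear_denominators. Qed.

(** The v coordinate is s * X21 - g21 instead of s * X21, because the subtracted multiple of q has x
    coordinate - g21 * (-1). In [h31_v] the subtracted multiple of h20 has the same effect. *)
Lemma h21_v :
  s * (s * X21 - g21 s e) - s ^+ 2 * X21
  + 2 * e * (s * X21 - g21 s e) + 2 * s * W21 =
    (C (-1) e (-1) e 1 e).1
    + (B 1 e X20 W20).1
    + 2 * (B (-1) e X11 W11).1
    + g21 s e * s.
Proof. by clear_denominators. Qed.

Lemma h21_w :
  s * W21 + e * s * X21 =
    (C (-1) e (-1) e 1 e).2
    + (B 1 e X20 W20).2
    + 2 * (B (-1) e X11 W11).2
    - g21 s e * e.
Proof. by clear_denominators. Qed.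

(** The system for h21 is singular, s being an eigenvalue; this equation, the orthogonality to [p]
    in the form of [inner_emb], selects its solution. *)
Lemma h21_orth :
  - X21 / 2 - ((s * X21 - g21 s e) / 2 - W21) / (2 * e + s) = 0.
Proof. by clear_denominators. Qed.

Lemma h31_v :
  2 * s * (2 * s * X31 + 3 * g21 s e * X20) - s ^+ 2 * X31
  + 2 * e * (2 * s * X31 + 3 * g21 s e * X20) + 2 * s * W31 =
    3 * (B (-1) e X21 W21).1
    + (B 1 e X30 W30).1
    + 3 * (B X20 W20 X11 W11).1
    + 3 * (C (-1) e (-1) e X11 W11).1
    + 3 * (C (-1) e 1 e X20 W20).1
    + (D (-1) e (-1) e (-1) e 1 e).1
    - 3 * g21 s e * (2 * s * X20).
Proof. by clear_denominators. Qed.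

Lemma h31_w :
  2 * s * W31 + e * s * X31 =
    3 * (B (-1) e X21 W21).2
    + (B 1 e X30 W30).2
    + 3 * (B X20 W20 X11 W11).2
    + 3 * (C (-1) e (-1) e X11 W11).2
    + 3 * (C (-1) e 1 e X20 W20).2
    + (D (-1) e (-1) e (-1) e 1 e).2
    - 3 * g21 s e * W20.
Proof. by clear_denominators. Qed.

Lemma h22_v :
  - s ^+ 2 * X22 + 2 * s * W22 =
    (D (-1) e (-1) e 1 e 1 e).1
    + 4 * (C (-1) e 1 e X11 W11).1
    + (C 1 e 1 e X20 W20).1
    + (C (-1) e (-1) e X20' W20').1
    + 2 * (B X11 W11 X11 W11).1
    + 2 * (B (-1) e X21' W21').1
    + 2 * (B 1 e X21 W21).1
    + (B X20' W20' X20 W20).1.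
Proof. by clear_denominators. Qed.

Lemma h22_w :
  e * s * X22 =
    (D (-1) e (-1) e 1 e 1 e).2
    + 4 * (C (-1) e 1 e X11 W11).2
    + (C 1 e 1 e X20 W20).2
    + (C (-1) e (-1) e X20' W20').2
    + 2 * (B X11 W11 X11 W11).2
    + 2 * (B (-1) e X21' W21').2
    + 2 * (B 1 e X21 W21).2
    + (B X20' W20' X20 W20).2.
Proof. by clear_denominators. Qed.

Lemma g32_def :
  g32 s e =
    - ((6 * (B X11 W11 X21 W21).1
    + (B X20' W20' X30 W30).1
    + 3 * (B X21' W21' X20 W20).1
    + 3 * (B (-1) e X22 W22).1
    + 2 * (B 1 e X31 W31).1
    + 6 * (C (-1) e X11 W11 X11 W11).1
    + 3 * (C (-1) e X20' W20' X20 W20).1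
    + 3 * (C (-1) e (-1) e X21' W21').1
    + 6 * (C (-1) e 1 e X21 W21).1
    + 6 * (C 1 e X20 W20 X11 W11).1
    + (C 1 e 1 e X30 W30).1
    + (D (-1) e (-1) e (-1) e X20' W20').1
    + 6 * (D (-1) e (-1) e 1 e X11 W11).1
    + 3 * (D (-1) e 1 e 1 e X20 W20).1
    + (E (-1) e (-1) e (-1) e 1 e 1 e).1) / 2
     - (6 * (B X11 W11 X21 W21).2
    + (B X20' W20' X30 W30).2
    + 3 * (B X21' W21' X20 W20).2
    + 3 * (B (-1) e X22 W22).2
    + 2 * (B 1 e X31 W31).2
    + 6 * (C (-1) e X11 W11 X11 W11).2
    + 3 * (C (-1) e X20' W20' X20 W20).2
    + 3 * (C (-1) e (-1) e X21' W21').2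
    + 6 * (C (-1) e 1 e X21 W21).2
    + 6 * (C 1 e X20 W20 X11 W11).2
    + (C 1 e 1 e X30 W30).2
    + (D (-1) e (-1) e (-1) e X20' W20').2
    + 6 * (D (-1) e (-1) e 1 e X11 W11).2
    + 3 * (D (-1) e 1 e 1 e X20 W20).2
    + (E (-1) e (-1) e (-1) e 1 e 1 e).2)) / (2 * e + s).
Proof. by clear_denominators. Qed.

Let d1 : e ^+ 2 - s ^+ 2 != 0.
Proof. by rewrite subr_sqr mulrC mulf_neq0. Qed.

Let d2 : 4 * e ^+ 2 - s ^+ 2 != 0.
Proof.
by rewrite (_ : _ - _ = (2 * e + s) * (2 * e - s)) ?mulf_neq0 //; ring.
Qed.

Let d3 : 4 * e ^+ 2 - 9 * s ^+ 2 != 0.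
Proof.
by rewrite (_ : _ - _ = (2 * e + 3 * s) * (2 * e - 3 * s)) ?mulf_neq0 //; ring.
Qed.

(** Conjugation exchanges s and -s, so the left side is twice a real part. Each denominator e + s is
    paired with e - s and 2e + s with 2e - s, which leaves polynomials in s^2 and e^2, hence real
    quantities. *)
Lemma g21_sym :
  g21 s e + g21 (- s) e =
    2 * (e * s ^+ 2 * bautin_poly (s ^+ 2) (e ^+ 2)
         / ((e ^+ 2 - s ^+ 2) * (4 * e ^+ 2 - s ^+ 2))).
Proof.
rewrite /bautin_poly /g21.
by field; rewrite ?pnatr_eq0 ?mulrN ?opprK ?s0 ?e1p ?e1m ?e2p ?e2m
  ?d1 ?d2.
Qed.

Lemma g32_sym :
  g32 s e + g32 (- s) e =
    2 * (e * second_poly (s ^+ 2) (e ^+ 2)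
         / (3 * (e ^+ 2 - s ^+ 2) ^+ 3 * (4 * e ^+ 2 - s ^+ 2) ^+ 3
            * (4 * e ^+ 2 - 9 * s ^+ 2))).
Proof.
rewrite /second_poly /g32.
by field; rewrite ?pnatr_eq0 ?mulrN ?opprK ?s0 ?e1p ?e1m ?e2p ?e2m
  ?e3p ?e3m ?d1 ?d2 ?d3.
Qed.

End CoefficientEquations.

(** * The Taylor forms at the equilibrium *)

Section VectorFieldTowers.
Variable R : realType.

(** The combinations of sine and cosine are stable under differentiation, so the k-th derivative is
    a recursion on the two coefficients; [trig2] does the same at the double angle. *)
Fixpoint trig (a b : R) (k : nat) (x : R) : R :=
  if k is k'.+1 then trig (- b) a k' x else a * sin x + b * cos x.

Lemma tower_trig a b : derivative_tower (trig a b).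
Proof.
move=> k x; elim: k a b => [|k IH] a b; last exact: IH.
have H := is_deriveD (is_deriveZ a (is_derive_sin x))
  (is_deriveZ b (is_derive_cos x)).
by apply: (is_derive_eq H); rewrite /GRing.scale /=; ring.
Qed.

Fixpoint trig2 (a b : R) (k : nat) (x : R) : R :=
  if k is k'.+1 then trig2 (- 4 * b) a k' x
  else a * (sin x * cos x) + b * (cos x ^+ 2 - sin x ^+ 2).

Lemma tower_trig2 a b : derivative_tower (trig2 a b).
Proof.
move=> k x; elim: k a b => [|k IH] a b; last exact: IH.
have ds := is_derive_sin x; have dc := is_derive_cos x.
have H := is_deriveD (is_deriveZ a (is_deriveM ds dc))
  (is_deriveZ b (is_deriveB (is_deriveX 2 dc) (is_deriveX 2 ds))).
by apply: (is_derive_eq H); rewrite /GRing.scale /=; ring.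
Qed.

Definition cos_minus (alpha beta : R) (k : nat) (x : R) : R :=
  if k is 0%N then alpha * (cos x - beta) else trig 0 alpha k x.

Lemma tower_cos_minus alpha beta : derivative_tower (cos_minus alpha beta).
Proof.
move=> [|k] x; last exact: (tower_trig _ _ k.+1 x).
have H := is_deriveZ alpha (is_deriveB (is_derive_cos x) (is_derive_cst beta x
  1)).
by apply: (is_derive_eq H); rewrite /GRing.scale /=; ring.
Qed.

Variables beta alpha eps : R.
Local Notation vf i := (fun X => vfield beta alpha eps X i 0).
Local Notation tower0 := (@tower0 R).

Lemma vfield0 : vf 0 = zquad tower0 tower0 tower0 1.
Proof.
by apply/funext => X; rewrite /vfield /zquad /tower0 !mxE /=; ring.
Qed.

Lemma vfield1 : vf 1 = zquad (trig2 1 0) tower0 (trig (-1) 0) (- eps).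
Proof.
by apply/funext => X; rewrite /vfield /zquad /tower0 !mxE /=; ring.
Qed.

Lemma vfield2 : vf 2 = zquad tower0 tower0 (cos_minus alpha beta) 0.
Proof.
by apply/funext => X; rewrite /vfield /zquad /tower0 !mxE /=; ring.
Qed.

Lemma vfield_diff0 (u v : 'cV[R[i]]_3) us :
  vfield_diff beta alpha eps [:: u, v & us] 0 0 = 0.
Proof.
have t0 := @tower_tower0 R.
rewrite mxE vfield0 kth_diff_cons2 // (_ : next_tower _ = tower0) //.
rewrite (_ : twice_tower _ = tower0) ?kth_diff_tower0 ?mulr0 ?addr0 //.
by apply/funext => k; apply/funext => x; rewrite /twice_tower mulr0.
Qed.

End VectorFieldTowers.

Lemma col3_eq (T : Type) (u v : 'cV[T]_3) :
  u 0 0 = v 0 0 -> u 1 0 = v 1 0 -> u 2 0 = v 2 0 -> u = v.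
Proof.
move=> e0 e1 e2; apply/colP => -[[|[|[|//]]] lt3].
- by rewrite (_ : Ordinal _ = 0) //; apply: val_inj.
- by rewrite (_ : Ordinal _ = 1) //; apply: val_inj.
- by rewrite (_ : Ordinal _ = 2) //; apply: val_inj.
Qed.

(** * Normalized coordinates *)

Section ScaledCoordinates.
Variables (R : realType) (beta alpha : R).
Hypotheses (beta01 : 0 < beta < 1) (alpha_gt0 : 0 < alpha).
Local Open Scope complex_scope.

Definition rootb : R := Num.sqrt beta.
Definition sinb : R := Num.sqrt (1 - beta ^+ 2).

Lemma rootb_gt0 : 0 < rootb.
Proof. by case/andP: beta01 => b0 _; rewrite sqrtr_gt0. Qed.

Lemma rootb2 : rootb ^+ 2 = beta.
Proof. by case/andP: beta01 => b0 _; rewrite sqr_sqrtr // ltW. Qed.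

Lemma sinb2 : sinb ^+ 2 = 1 - beta ^+ 2.
Proof.
case/andP: beta01 => b0 b1; rewrite sqr_sqrtr // subr_ge0.
by rewrite expr_le1 // ltW.
Qed.

Lemma sinb_gt0 : 0 < sinb.
Proof.
case/andP: beta01 => b0 b1; rewrite sqrtr_gt0 subr_gt0.
by rewrite expr_lt1 // ltW.
Qed.

Lemma powR_half : beta `^ 2^-1 = rootb.
Proof. by case/andP: beta01 => b0 _; rewrite powR12_sqrt // ltW. Qed.

Lemma eps_cE : eps_c beta alpha = 2 * alpha * rootb ^+ 3.
Proof.
rewrite /eps_c; congr (_ * _); rewrite mulrC powRrM powR_half.
by rewrite (powR_mulrn 3) // ltW // rootb_gt0.
Qed.

Lemma omega0E : omega0 beta = sinb / rootb.
Proof.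
case/andP: beta01 => b0 b1; rewrite /omega0 sqrtrM ?sqrtrV ?ltW //.
by rewrite subr_gt0 expr_lt1 // ltW.
Qed.

Lemma P0_x : P0 beta 0 0 = acos beta. Proof. by rewrite mxE. Qed.

Lemma P0_z : P0 beta 2 0 = rootb^-1.
Proof. by rewrite mxE /= powRN powR_half. Qed.

Lemma cosP0 : cos (acos beta) = beta.
Proof.
case/andP: beta01 => b0 b1; rewrite acosK // in_itv /= (ltW b1) andbT.
by rewrite (le_trans _ (ltW b0)) ?lerN10.
Qed.

Lemma sinP0 : sin (acos beta) = sinb.
Proof.
case/andP: beta01 => b0 b1; rewrite sin_acos // (ltW b1) andbT.
by rewrite (le_trans _ (ltW b0)) ?lerN10.
Qed.

Local Notation K := R[i].
Local Notation T := (vfield_diff beta alpha (eps_c beta alpha)).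

Definition sigma : K := 'i%C * sinb%:C.
Definition e0 : K := (alpha * beta ^+ 2)%:C.
Let r : K := rootb%:C.

(* The vector with normalized coordinates (x, v, w), divided by beta ^+ n; the
   vector h_jk is of this form with n = j + k and x, v, w rational in sigma and
   e0. *)
Definition emb (n : nat) (x v w : K) : 'cV[K]_3 :=
  \col_i [:: r ^- (2 * n) * ('i%C * r ^+ 2 * x); r ^- (2 * n) * ('i%C * r * v);
             r ^- (2 * n) * (w / r)]`_i.

Lemma imag2 : 'i%C ^+ 2 = - 1 :> K.
Proof. by rewrite sqr_i. Qed.

Lemma r_neq0 : r != 0.
Proof. by rewrite fmorph_eq0 gt_eqF // rootb_gt0. Qed.

Lemma i_neq0 : 'i%C != 0 :> K.
Proof. by rewrite eq_complex /= oner_eq0 andbF. Qed.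

Lemma sinbC : sinb%:C = - 'i%C * sigma.
Proof. by rewrite /sigma mulNr mulrA -expr2 imag2 mulN1r opprK. Qed.

Lemma betaC : beta%:C = r ^+ 2.
Proof. by rewrite -rmorphXn /= rootb2. Qed.

Lemma sigma2 : sigma ^+ 2 = r ^+ 4 - 1.
Proof.
rewrite /sigma exprMn imag2 mulN1r -rmorphXn /= sinb2.
by rewrite (exprM r 2 2) -betaC rmorphB rmorph1 rmorphXn opprB.
Qed.

Lemma e0E : e0 = alpha%:C * r ^+ 4.
Proof. by rewrite /e0 rmorphM rmorphXn /= betaC -exprM. Qed.

(* In normalized coordinates the k-th differential of the vector field is r^-1
   times a form with vanishing x component. *)
Definition emb_rate (n : nat) (f : K * K) : 'cV[K]_3 :=
  r^-1 *: emb n 0 f.1 f.2.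

Let rX_neq0 k : r ^+ k != 0.
Proof. by rewrite expf_neq0 // r_neq0. Qed.

Ltac eval_component vfieldE kth_diffE :=
  rewrite [LHS]mxE vfieldE kth_diffE;
  [ | by [exact: tower_trig2 | exact: tower_tower0]
    | exact: tower_tower0
    | by [exact: tower_trig | exact: tower_cos_minus]];
  rewrite P0_x P0_z /= cosP0 ?sinP0 !mxE /= /tower0 /=;
  (* The relations given to [field] eliminate the square of i, the square of sigma, the sine and
     beta. *)
  rewrite !mulnDr !exprD; field: imag2 sigma2 sinbC betaC;
  rewrite r_neq0 !rX_neq0.

Ltac eval_form kth_diffE :=
  apply: col3_eq;
  [ by rewrite vfield_diff0 !mxE /= !mulr0
  | by eval_component vfield1 kth_diffE | by eval_component vfield2 kth_diffE ].

Lemma B_emb n1 x1 v1 w1 n2 x2 v2 w2 :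
  B beta alpha (emb n1 x1 v1 w1) (emb n2 x2 v2 w2) =
  emb_rate (n1 + n2) (form2 sigma e0 x1 w1 x2 w2).
Proof. eval_form kth_diff2. Qed.

Lemma C_emb n1 x1 v1 w1 n2 x2 v2 w2 n3 x3 v3 w3 :
  C beta alpha (emb n1 x1 v1 w1) (emb n2 x2 v2 w2) (emb n3 x3 v3 w3) =
  emb_rate (n1 + n2 + n3) (form3 sigma e0 x1 w1 x2 w2 x3 w3).
Proof. eval_form kth_diff3. Qed.

Lemma D_emb n1 x1 v1 w1 n2 x2 v2 w2 n3 x3 v3 w3 n4 x4 v4 w4 :
  D beta alpha (emb n1 x1 v1 w1) (emb n2 x2 v2 w2) (emb n3 x3 v3 w3)
    (emb n4 x4 v4 w4) =
  emb_rate (n1 + n2 + n3 + n4) (form4 sigma e0 x1 w1 x2 w2 x3 w3 x4 w4).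
Proof. eval_form kth_diff4. Qed.

Lemma E_emb n1 x1 v1 w1 n2 x2 v2 w2 n3 x3 v3 w3 n4 x4 v4 w4 n5 x5 v5 w5 :
  E beta alpha (emb n1 x1 v1 w1) (emb n2 x2 v2 w2) (emb n3 x3 v3 w3)
    (emb n4 x4 v4 w4) (emb n5 x5 v5 w5) =
  emb_rate (n1 + n2 + n3 + n4 + n5)
    (form5 sigma e0 x1 w1 x2 w2 x3 w3 x4 w4 x5 w5).
Proof. eval_form kth_diff5. Qed.

(** The normalized matrix has characteristic polynomial (X + 2e)(X^2 - sigma^2); its roots are r
    times the eigenvalues of the Jacobian matrix on the critical surface. *)
Lemma A_emb n x v w :
  A beta alpha *m emb n x v w =
  r^-1 *: emb n v (sigma ^+ 2 * x - 2 * e0 * v - 2 * sigma * w)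
              (- e0 * sigma * x).
Proof.
have [p0 p1 p2] := partial_zquad 1 (@tower_tower0 R) (@tower_tower0 R)
  (@tower_tower0 R).
have [q0 q1 q2] := partial_zquad (- eps_c beta alpha)
  (tower_trig2 1 0) (@tower_tower0 R) (tower_trig (-1) 0).
have [s0 s1 s2] := partial_zquad 0 (@tower_tower0 R) (@tower_tower0 R)
  (tower_cos_minus alpha beta).
apply: col3_eq; rewrite [LHS]mxE sum3 !mxE /= ?vfield0 ?vfield1 ?vfield2
  ?p0 ?p1 ?p2 ?q0 ?q1 ?q2 ?s0 ?s1 ?s2 /zquad /next_tower /tower0 /twice_tower /=
  ?P0_x ?P0_z ?cosP0 ?sinP0 ?eps_cE;
  (field: imag2 sigma2 sinbC betaC); by rewrite r_neq0 ?rX_neq0.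
Qed.

End ScaledCoordinates.

(** * Resolvents of the linear part *)

(** Preimages of the basis vectors are the columns of a right inverse. An explicit solution of the
    system thus replaces a determinant computation. *)
Lemma unitmx_surj (K : fieldType) (n : nat) (M : 'M[K]_n) :
  (forall u : 'cV_n, exists h, M *m h = u) -> M \in unitmx.
Proof.
move=> /choice[h hP].
have : M *m (\matrix_(i, j) h (delta_mx j 0) i 0) = 1%:M.
  apply/matrixP => i j; rewrite !mxE.
  have /matrixP/(_ i 0) := hP (delta_mx j 0); rewrite !mxE eqxx andbT => <-.
  by apply: eq_bigr => k _; rewrite !mxE.
by case/mulmx1_unit.
Qed.

Lemma invmx_mulE (K : fieldType) (n : nat) (M : 'M[K]_n) (h u : 'cV_n) :
  M \in unitmx -> M *m h = u -> invmx M *m u = h.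
Proof. by move=> Mu <-; rewrite mulKmx. Qed.

Section Resolvents.
Variables (R : realType) (beta alpha : R).
Hypotheses (beta01 : 0 < beta < 1) (alpha_gt0 : 0 < alpha).
Local Open Scope complex_scope.
Local Notation K := R[i].
Local Notation s := (sigma beta).
Local Notation e := (e0 beta alpha).
Local Notation r := ((rootb beta)%:C : K).
Local Notation emb := (emb beta).

Lemma e0_gt0 : 0 < alpha * beta ^+ 2.
Proof. by case/andP: beta01 => b0 _; rewrite mulr_gt0 // exprn_gt0. Qed.

(** Since s is purely imaginary, the real part is a times the positive number e. All denominators
    other than s are covered by this. *)
Lemma linear_neq0 (a c : R) : a != 0 -> a%:C * e + c%:C * s != 0.
Proof.
move=> a0; rewrite /e0 /sigma eq_complex negb_and; apply/orP; left.
rewrite (_ : complex.Re _ = a * (alpha * beta ^+ 2)) /=; last by ring.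
by rewrite mulf_neq0 // gt_eqF // e0_gt0.
Qed.

Lemma s_neq0 : s != 0.
Proof.
by rewrite /sigma mulf_neq0 ?i_neq0 // fmorph_eq0 gt_eqF // sinb_gt0.
Qed.

Lemma e_neq0 : e != 0.
Proof. by rewrite fmorph_eq0 gt_eqF // e0_gt0. Qed.

Lemma iwE : iw beta = s / r.
Proof. by rewrite /iw omega0E // rmorphM fmorphV mulrA. Qed.

Definition embr n x v w : 'cV[K]_3 := r^-1 *: emb n x v w.

Lemma emb_rateE n f : emb_rate beta n f = embr n 0 f.1 f.2.
Proof. by []. Qed.

Lemma embD n x v w x' v' w' :
  emb n x v w + emb n x' v' w' = emb n (x + x') (v + v') (w + w').
Proof. by apply: col3_eq; rewrite !mxE /=; ring. Qed.

Lemma embZ c n x v w : c *: emb n x v w = emb n (c * x) (c * v) (c * w).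
Proof. by apply: col3_eq; rewrite !mxE /=; ring. Qed.

Lemma emb_shift m n x v w : r ^- (2 * m) *: emb n x v w = emb (m + n) x v w.
Proof.
by apply: col3_eq; rewrite !mxE /= mulnDr exprD invfM mulrA.
Qed.

Lemma embrD n x v w x' v' w' :
  embr n x v w + embr n x' v' w' = embr n (x + x') (v + v') (w + w').
Proof. by rewrite -scalerDr embD. Qed.

Lemma embrZ c n x v w : c *: embr n x v w = embr n (c * x) (c * v) (c * w).
Proof. by rewrite /embr scalerA mulrC -scalerA embZ. Qed.

Lemma emb_surj n u : exists x v w, u = emb n x v w.
Proof.
have rn := r_neq0 beta01.
have rX : r ^+ (2 * n) != 0 by rewrite expf_neq0.
exists (r ^+ (2 * n) * (u 0 0 / ('i%C * r ^+ 2))),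
  (r ^+ (2 * n) * (u 1 0 / ('i%C * r))), (r ^+ (2 * n) * (r * u 2 0)).
by apply: col3_eq; rewrite !mxE /=; field; rewrite ?rX ?rn ?i_neq0.
Qed.

Lemma resolvent_emb m n x v w :
  ((m * iw beta)%:M - A beta alpha) *m emb n x v w =
  embr n (m * s * x - v)
    (m * s * v - s ^+ 2 * x + 2 * e * v + 2 * s * w) (m * s * w + e * s * x).
Proof.
rewrite mulmxBl mul_scalar_mx A_emb // iwE.
have -> : m * (s / r) = r^-1 * (m * s) by rewrite mulrA mulrC.
rewrite -scalerA -scalerBr embZ -scaleN1r embZ embD /embr; congr (_ *: emb _ _
  _ _); ring.
Qed.

(** The characteristic polynomial at m s is (m s + 2e)(m^2 - 1) s^2. The preimage of an arbitrary
    vector is written by Cramer's rule, this determinant appearing in [d]. *)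
Lemma resolvent_unit m : (m * s + 2 * e) * (m ^+ 2 - 1) != 0 ->
  (m * iw beta)%:M - A beta alpha \in unitmx.
Proof.
rewrite mulf_eq0 negb_or => /andP[d1 d2]; apply: unitmx_surj => u.
have [a [b [c ->]]] := emb_surj 0 u.
have rn := r_neq0 beta01.
pose d := (m * s + 2 * e) * (m ^+ 2 - 1) * s ^+ 2 / r.
exists (emb 0
  (((m * s + 2 * e) * m * s * a + m * s * b - 2 * s * c) / d)
  (((m * s + 2 * e) * s ^+ 2 * a + m ^+ 2 * s ^+ 2 * b - 2 * m * s ^+ 2 * c) /
    d)
  ((- e * s * (m * s + 2 * e) * a - e * s * b
    + (m * s * (m * s + 2 * e) - s ^+ 2) * c) / d)).
rewrite resolvent_emb /embr embZ /d; have sn := s_neq0.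
congr (emb _ _ _ _); move: d1 rn sn; move: e r s => e' r' s' d1 rn sn;
  by field; rewrite rn sn d1 d2.
Qed.

Lemma conj_imag : conjc ('i%C : K) = - 'i%C.
Proof. by apply/eqP; rewrite eq_complex /= oppr0 !eqxx. Qed.

Lemma conj_s : conjc s = - s.
Proof.
transitivity (conjc 'i%C * conjc (sinb beta)%:C : K); first exact: rmorphM.
by rewrite conj_imag conjc_real mulNr.
Qed.

Lemma conj_e : conjc e = e.
Proof. exact: conjc_real. Qed.

Lemma qE : q beta alpha = emb 1 (-1) (- s) e.
Proof.
have rn := r_neq0 beta01; have i2 := @imag2 R.
apply: col3_eq; rewrite !mxE /=.
- by rewrite muln1; move: r rn => r' rn; field; rewrite rn.
- rewrite omega0E // rmorphM fmorphV /= sinbC // muln1.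
  by move: r rn s => r' rn s'; field; rewrite rn.
- rewrite eps_cE // e0E // !(rmorphM, fmorphV, rmorphXn, rmorph_nat) /= (betaC
  beta01).
  by move: r rn alpha%:C => r' rn a; rewrite muln1; field; rewrite rn.
Qed.

(** The factor i carried by the first two coordinates changes sign under conjugation. Hence the
    conjugate of h20 has coordinates [- h20x (- s) e] but [h20w (- s) e]. *)
Lemma bar_emb n x v w : bar (emb n x v w) = emb n (- conjc x) (- conjc v)
  (conjc w).
Proof.
have ci := conj_imag; have cr := conjc_real (rootb beta).
apply: col3_eq; rewrite !mxE /=; move: ci cr; move: r 'i%C => r' i' ci cr;
  rewrite !(rmorphM, fmorphV, rmorphXn) /= cr ?ci; ring.
Qed.

Lemma inner_emb n x v w : inner (p beta alpha) (emb n x v w) =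
  r ^+ 2 / r ^+ (2 * n) * (- x / 2 - (v / 2 - w) / (2 * e + s)).
Proof.
have rn := r_neq0 beta01; have i2 := @imag2 R; have ni := @i_neq0 R.
have s2 := sigma2 beta01.
have d1 : 2 * e + s != 0.
  have := @linear_neq0 2 1; rewrite mul1r rmorph_nat; apply.
  by rewrite pnatr_eq0.
have d2 : 2 * e - s != 0.
  have := @linear_neq0 2 (-1); rewrite rmorphN rmorph1 mulN1r rmorph_nat.
  by apply; rewrite pnatr_eq0.
have rX : r ^+ (2 * n) != 0 by rewrite expf_neq0.
(* The conjugated entries 1 and 2 of [p] have the factor 2e - s in their numerators; it cancels
   against this factorization, and only 2e + s is left in the pairing. *)
have dE : (omega0 beta ^+ 2 + eps_c beta alpha ^+ 2)%:C =
    (2 * e + s) * (2 * e - s) / r ^+ 2.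
  rewrite eps_cE // omega0E // e0E // !(rmorphD, rmorphM, fmorphV, rmorphXn,
    rmorph_nat) /=.
  rewrite sinbC //.
  by move: r rn s alpha%:C i2 => r' rn s' a i2; field: i2; rewrite rn.
have wE : (omega0 beta)%:C = - 'i%C * s / r.
  by rewrite omega0E // rmorphM fmorphV /= sinbC.
have eE : (eps_c beta alpha)%:C = 2 * e / r.
  rewrite eps_cE // e0E // !(rmorphM, rmorphXn, rmorph_nat) /=.
  by move: r rn alpha%:C => r' rn' a; field; rewrite rn'.
have ci := conj_imag; have cs := conj_s; have ce := conj_e.
have cr := conjc_real (rootb beta).
have eD : (2 * (omega0 beta ^+ 2 + eps_c beta alpha ^+ 2))%:C =
    2 * (omega0 beta ^+ 2 + eps_c beta alpha ^+ 2)%:C.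
  by rewrite rmorphM rmorph_nat.
have p0 : p beta alpha 0 0 = - 'i%C / 2 by rewrite mxE.
have p1 : p beta alpha 1 0 =
    ((omega0 beta)%:C - 'i%C * (eps_c beta alpha)%:C)
    / (2 * (omega0 beta ^+ 2 + eps_c beta alpha ^+ 2))%:C by rewrite mxE.
have p2 : p beta alpha 2 0 =
    beta%:C * ((eps_c beta alpha)%:C + 'i%C * (omega0 beta)%:C)
    / (omega0 beta ^+ 2 + eps_c beta alpha ^+ 2)%:C by rewrite mxE.
rewrite /inner sum3 p0 p1 p2 ![emb _ _ _ _ _ _]mxE.
move: ci cs ce cr i2 ni; rewrite eD dE wE eE (betaC beta01).
move: d1 d2 rn rX; rewrite {p0 p1 p2 dE wE eE eD s2}.
move: (r) (s) (e) ('i%C : K).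
move=> r' s' e' i' d1 d2 rn rX ci cs ce cr i2 ni.
rewrite !(rmorphM, fmorphV, rmorphD, rmorphN, rmorphXn, rmorph1) /=.
rewrite ci cs ce cr.
field: i2; by rewrite rn rX d1 d2.
Qed.

End Resolvents.

(** * The normal form vectors *)

Section NormalFormCoefficients.
Variables (R : realType) (beta alpha : R).
Hypotheses (beta01 : 0 < beta < 1) (alpha_gt0 : 0 < alpha).
Local Open Scope complex_scope.
Local Notation K := R[i].
Local Notation s := (sigma beta).
Local Notation e := (e0 beta alpha).
Local Notation r := ((rootb beta)%:C : K).
Local Notation emb := (emb beta).
Local Notation embr := (embr beta).
Local Notation q := (q beta alpha).

Let sn : s != 0. Proof. exact: s_neq0. Qed.
Let en : e != 0. Proof. exact: e_neq0. Qed.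
Let rn : r != 0. Proof. exact: r_neq0. Qed.

Let lin_neq0 (a : nat) (z : int) : (0 < a)%N ->
  a%:R * e + z%:~R * s != 0.
Proof.
move=> a0; have := @linear_neq0 R beta alpha beta01 alpha_gt0 a%:R z%:~R.
by rewrite rmorph_nat rmorph_int; apply; rewrite pnatr_eq0 -lt0n.
Qed.

Let e1p : e + s != 0. Proof. by have := @lin_neq0 1 1 isT; rewrite !mul1r. Qed.
Let e1m : e - s != 0.
Proof. by have := @lin_neq0 1 (-1) isT; rewrite mul1r mulN1r. Qed.
Let e2p : 2 * e + s != 0.
Proof. by have := @lin_neq0 2 1 isT; rewrite mul1r. Qed.
Let e2m : 2 * e - s != 0.
Proof. by have := @lin_neq0 2 (-1) isT; rewrite mulN1r. Qed.
Let e3p : 2 * e + 3 * s != 0.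
Proof. exact: (@lin_neq0 2 3 isT). Qed.
Let e3m : 2 * e - 3 * s != 0.
Proof. by have := @lin_neq0 2 (-3) isT; rewrite mulrNz mulNr. Qed.

Let Bemb := @B_emb R beta alpha beta01.
Let Cemb := @C_emb R beta alpha beta01.
Let Demb := @D_emb R beta alpha beta01.
Let Eemb := @E_emb R beta alpha beta01.
Let q_emb := @qE R beta alpha beta01.

Lemma congr_embr n x v w x' v' w' : x = x' -> v = v' -> w = w' ->
  embr n x v w = embr n x' v' w'.
Proof. by move=> -> -> ->. Qed.

Lemma conj_at_s (f : K -> K -> K) :
  (forall g : {rmorphism K -> K}, g (f s e) = f (g s) (g e)) ->
  conjc (f s e) = f (- s) e.
Proof.
move=> fE; transitivity (f (conjc s) (conjc e)); first exact: fE.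
by rewrite conj_s conj_e.
Qed.

Lemma embr0D n v w v' w' :
  embr n 0 v w + embr n 0 v' w' = embr n 0 (v + v') (w + w').
Proof. by rewrite embrD addr0. Qed.

Lemma embr0Z c n v w : c *: embr n 0 v w = embr n 0 (c * v) (c * w).
Proof. by rewrite embrZ mulr0. Qed.

Lemma embrN n x v w : - embr n x v w = embr n (- x) (- v) (- w).
Proof. by rewrite -scaleN1r embrZ !mulN1r. Qed.

Lemma qbE : bar q = emb 1 1 (- s) e.
Proof.
rewrite q_emb bar_emb conj_e.
have -> : conjc (- 1 : K) = - 1 by exact: (rmorphN1 conjc).
rewrite (@conj_at_s (fun x _ => - x)); last by move=> g; rewrite rmorphN.
by rewrite !opprK.
Qed.

Lemma A_unit : A beta alpha \in unitmx.
Proof.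
have := @resolvent_unit R beta alpha beta01 0.
have -> : (0 * iw beta)%:M - A beta alpha = - 1 *: A beta alpha.
  by rewrite mul0r raddf0 sub0r scaleN1r.
rewrite unitmxZ ?unitrN1 //; apply.
rewrite mul0r add0r expr0n /= sub0r mulf_neq0 ?oppr_eq0 ?oner_eq0 //.
by rewrite mulf_neq0 ?pnatr_eq0.
Qed.

Lemma invmx_A_embr n x v w a b : v = 0 ->
  - s ^+ 2 * x + 2 * s * w = a -> e * s * x = b ->
  - (invmx (A beta alpha) *m embr n 0 a b) = emb n x v w.
Proof.
move=> -> <- <-.
rewrite (@invmx_mulE _ _ _ (emb n (- x) 0 (- w))) ?A_unit //.
  by rewrite -scaleN1r embZ; congr (emb _ _ _ _); ring.
by rewrite A_emb // /embr; congr (_ *: emb _ _ _ _); ring.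
Qed.

Lemma resolvent_embr (m : K) n x v w a b c :
  (m * s + 2 * e) * (m ^+ 2 - 1) != 0 -> m * s * x - v = a ->
  m * s * v - s ^+ 2 * x + 2 * e * v + 2 * s * w = b ->
  m * s * w + e * s * x = c ->
  invmx ((m * iw beta)%:M - A beta alpha) *m embr n a b c = emb n x v w.
Proof.
move=> mu <- <- <-; apply: invmx_mulE; first exact: resolvent_unit.
by rewrite resolvent_emb.
Qed.

Let unit2 : (2 * s + 2 * e) * (2 ^+ 2 - 1) != 0.
Proof.
rewrite -mulrDr addrC !mulf_neq0 ?pnatr_eq0 ?e1p //.
by rewrite (_ : 2 ^+ 2 - 1 = 3) ?pnatr_eq0 //; ring.
Qed.

Let unit3 : (3 * s + 2 * e) * (3 ^+ 2 - 1) != 0.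
Proof.
rewrite addrC mulf_neq0 ?e3p //.
by rewrite (_ : 3 ^+ 2 - 1 = 8) ?pnatr_eq0 //; ring.
Qed.

Lemma h11E : h11 beta alpha = emb 2 (h11x s) 0 (h11w s e).
Proof.
rewrite /h11 qbE q_emb Bemb emb_rateE.
by apply: invmx_A_embr => //; [exact: h11_v | exact: h11_w].
Qed.

Lemma h20E :
  h20 beta alpha = emb 2 (h20x s e) (2 * s * h20x s e) (h20w s e).
Proof.
rewrite /h20 q_emb Bemb emb_rateE.
by apply: resolvent_embr; [|exact: subrr|exact: h20_v|exact: h20_w].
Qed.

Lemma h20bE :
  bar (h20 beta alpha) = emb 2 (- h20x (- s) e) (- conjc (2 * s * h20x s e))
    (h20w (- s) e).
Proof.
rewrite h20E bar_emb (conj_at_s (fun g => rmorph_h20x g s e)).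
by rewrite (conj_at_s (fun g => rmorph_h20w g s e)).
Qed.

Lemma h30E :
  h30 beta alpha = emb 3 (h30x s e) (3 * s * h30x s e) (h30w s e).
Proof.
rewrite /h30 h20E q_emb Bemb Cemb !emb_rateE !embr0Z embr0D.
by apply: resolvent_embr; [|exact: subrr|exact: h30_v|exact: h30_w].
Qed.

Lemma r21E : r21 beta alpha = embr 3 0
  ((form3 s e (-1) e (-1) e 1 e).1 + (form2 s e 1 e (h20x s e) (h20w s e)).1
   + 2 * (form2 s e (-1) e (h11x s) (h11w s e)).1)
  ((form3 s e (-1) e (-1) e 1 e).2 + (form2 s e 1 e (h20x s e) (h20w s e)).2
   + 2 * (form2 s e (-1) e (h11x s) (h11w s e)).2).
Proof.
by rewrite /r21 h20E h11E qbE q_emb !Bemb Cemb !emb_rateE !embr0Z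
  !embr0D.
Qed.

Lemma inner_embr n v w : inner (Defs.p beta alpha) (embr n.+1 0 v w) =
  r^-1 * r ^- (2 * n) * (- (v / 2 - w) / (2 * e + s)).
Proof.
have innerZ c (u : 'cV[K]_3) :
    inner (Defs.p beta alpha) (c *: u) = c * inner (Defs.p beta alpha) u.
  rewrite /inner mulr_sumr; apply: eq_bigr => i _.
  by rewrite [(c *: u) _ _]mxE mulrCA.
have rX : r ^+ (2 * n) != 0 by rewrite expf_neq0.
rewrite /embr innerZ inner_emb // mulnS exprD.
move: (r ^+ (2 * n)) (2 * e + s) e2p (r) rX rn => t d d0 r' t0 r0.
by field; rewrite t0 d0 r0.
Qed.

Lemma G21E : G21 beta alpha = r^-1 * r ^- 4 * g21 s e.
Proof. by rewrite /G21 r21E inner_embr g21_def // mulNr. Qed.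

(** Of the factor r^-5 in [G21], r^-1 turns [emb] into [embr] and r^-4 raises the index by two, so
    that the multiples of q and h20 match the other terms of their equations. *)
Lemma G21_scale n c x v w : (c * G21 beta alpha) *: emb n x v w =
  embr (2 + n) (c * g21 s e * x) (c * g21 s e * v) (c * g21 s e * w).
Proof.
rewrite G21E (_ : c * _ = r^-1 * (c * g21 s e) * r ^- (2 * 2)); last first.
  by move: (g21 s e) (r) rn => g r' rn'; field.
by rewrite -mulrA -scalerA -scalerA emb_shift embZ.
Qed.

Definition h21v : K := s * h21x s e - g21 s e.

Lemma emb_eq0 n x v w : emb n x v w = 0 -> [/\ x = 0, v = 0 & w = 0].
Proof.
have rX : r ^- (2 * n) != 0 by rewrite invr_eq0 expf_neq0.
have ni := @i_neq0 R; move=> /colP E; split.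
- have c0 : r ^- (2 * n) * ('i%C * r ^+ 2) != 0.
    by rewrite !mulf_neq0 ?expf_neq0.
  by apply: (mulfI c0); have := E 0; rewrite !mxE /= mulrA => ->; rewrite mulr0.
- have c0 : r ^- (2 * n) * ('i%C * r) != 0 by rewrite !mulf_neq0.
  by apply: (mulfI c0); have := E 1; rewrite !mxE /= mulrA => ->; rewrite mulr0.
- have c0 : r ^- (2 * n) / r != 0 := mulf_neq0 rX (invr_neq0 rn).
  by apply: (mulfI c0); have := E 2; rewrite !mxE /= (mulrC w) mulrA => ->;
    rewrite mulr0.
Qed.

Lemma innerB (u v w : 'cV[K]_3) : inner u (v - w) = inner u v - inner u w.
Proof.
rewrite /inner -sumrB; apply: eq_bigr => i _.
by rewrite [(v - w) _ _]mxE [(- w) _ _]mxE mulrDr mulrN.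
Qed.

(** A kernel vector has v = s x and w = - e x, so it is a multiple of q, and its pairing with [p] is
    - x up to a nonzero factor. This is the uniqueness on which the choice of [h21] by [xget]
    relies. *)
Lemma critical_kernel_eq0 (u : 'cV[K]_3) :
  ((iw beta)%:M - A beta alpha) *m u = 0 -> inner (Defs.p beta alpha) u = 0 ->
  u = 0.
Proof.
have [x [v [w ->]]] := emb_surj beta01 1 u.
rewrite -[iw beta]mul1r resolvent_emb // => /eqP; rewrite scaler_eq0 invr_eq0.
rewrite (negbTE rn) => /eqP /emb_eq0[vE _ wE].
rewrite inner_emb // => /eqP; rewrite mulf_eq0 mulf_eq0 invr_eq0 !expf_eq0.
rewrite (negbTE rn) !andbF /= => /eqP xE.
have {vE} vE : v = s * x by apply/esym/eqP; rewrite -subr_eq0 -vE mul1r.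
have {wE} wE : w = - e * x.
  apply: (mulfI sn); apply/eqP; rewrite -subr_eq0 -wE; apply/eqP; ring.
have x0 : x = 0.
  rewrite -[LHS]opprK -[RHS]oppr0 -xE vE wE; congr (- _).
  by move: s e e2p => s' e' d; field; rewrite d.
rewrite vE wE x0 !mulr0; apply: col3_eq; rewrite !mxE /= ?mul0r !mulr0 //.
Qed.

Lemma h21E : h21 beta alpha = emb 3 (h21x s e) h21v (h21w s e).
Proof.
have rE : r21 beta alpha - G21 beta alpha *: q =
    embr 3 (s * h21x s e - h21v)
      (s * h21v - s ^+ 2 * h21x s e + 2 * e * h21v + 2 * s * h21w s e)
      (s * h21w s e + e * s * h21x s e).
  rewrite h21_v // h21_w // r21E q_emb -[G21 _ _]mul1r G21_scale.
  rewrite embrN embrD.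
  by apply: congr_embr; rewrite /h21v; ring.
have hP : ((iw beta)%:M - A beta alpha) *m emb 3 (h21x s e) h21v (h21w s e) =
    r21 beta alpha - G21 beta alpha *: q.
  rewrite rE -[iw beta]mul1r resolvent_emb; last exact: beta01.
  by apply: congr_embr; rewrite !mul1r.
have h0 : inner (Defs.p beta alpha) (emb 3 (h21x s e) h21v (h21w s e)) = 0.
  by rewrite inner_emb // /h21v h21_orth // mulr0.
apply: xget_unique => [|y] /=; first by [].
move=> [yP y0]; apply/eqP; rewrite -subr_eq0; apply/eqP.
apply: critical_kernel_eq0; first by rewrite mulmxBr hP yP subrr.
by rewrite innerB y0 h0 subrr.
Qed.

Lemma h21bE : bar (h21 beta alpha) =
  emb 3 (- h21x (- s) e) (- conjc h21v) (h21w (- s) e).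
Proof.
rewrite h21E bar_emb (conj_at_s (fun g => rmorph_h21x g s e)).
by rewrite (conj_at_s (fun g => rmorph_h21w g s e)).
Qed.

Lemma h31E : h31 beta alpha = emb 4 (h31x s e)
  (2 * s * h31x s e + 3 * g21 s e * h20x s e) (h31w s e).
Proof.
rewrite /h31 h20E h11E h30E h21E qbE q_emb G21_scale.
rewrite !Bemb !Cemb Demb !emb_rateE !embr0Z !embr0D embrN embrD.
apply: resolvent_embr; first exact: unit2.
- move: (2 * s * h31x s e) (3 * _ * _) => X g.
  by rewrite opprD addrA subrr.
- rewrite h31_v //; congr (_ + _); ring.
- rewrite h31_w //.
Qed.

Lemma h22E : h22 beta alpha = emb 4 (h22x s e) 0 (h22w s e).
Proof.
rewrite /h22 h20bE h21bE h20E h11E h21E qbE q_emb.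
rewrite !Bemb !Cemb Demb !emb_rateE !embr0Z !embr0D.
by apply: invmx_A_embr => //; [exact: h22_v | exact: h22_w].
Qed.

(* Rewriting in the large sum defining G32 is slow: its value is synthesized
   summand by summand. *)
Lemma embr0D_eq n (u u' : 'cV[K]_3) v w v' w' :
  u = embr n 0 v w -> u' = embr n 0 v' w' ->
  u + u' = embr n 0 (v + v') (w + w').
Proof. by move=> -> ->; exact: embr0D. Qed.

Lemma embr0Z_eq n c (u : 'cV[K]_3) v w :
  u = embr n 0 v w -> c *: u = embr n 0 (c * v) (c * w).
Proof. by move=> ->; exact: embr0Z. Qed.

Lemma G32E : G32 beta alpha = r^-1 * r ^- 8 * g32 s e.
Proof.
rewrite /G32 h20bE h21bE h22E h31E h30E h20E h11E h21E qbE q_emb.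
eapply eq_trans.
  apply: (f_equal (inner (Defs.p beta alpha))).
  repeat first [eapply embr0D_eq | eapply embr0Z_eq];
    first [exact: Bemb | exact: Cemb | exact: Demb | exact: Eemb].
(* Every summand has index 5, the number of factors q and bar q in it; [inner_embr] takes the
   predecessor of the index. *)
apply: etrans (inner_embr 4 _ _) _.
by apply: (f_equal (fun x : K => r^-1 * r ^- 8 * x)); apply/esym/g32_def.
Qed.

Lemma denominators_neq0 :
  (s != 0) * (e != 0) * (e + s != 0) * (e - s != 0)
  * (2 * e + s != 0) * (2 * e - s != 0)
  * (2 * e + 3 * s != 0) * (2 * e - 3 * s != 0).
Proof. by do !split. Qed.

End NormalFormCoefficients.

(** * Real parts *)

Section RealParts.
Variables (R : realType) (beta alpha : R).
Hypotheses (beta01 : 0 < beta < 1) (alpha_gt0 : 0 < alpha).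
Local Open Scope complex_scope.
Local Notation K := R[i].
Local Notation s := (sigma beta).
Local Notation e := (e0 beta alpha).
Local Notation r := ((rootb beta)%:C : K).
Local Notation S := (beta ^+ 2 - 1).
Local Notation W := ((alpha * beta ^+ 2) ^+ 2).

(** As r is real, the conjugate of z is obtained by replacing s with -s in f, and 2 Re z is the sum
    of the two. *)
Lemma real_part (n : nat) (z : K) (f : K -> K -> K) (x : R) :
  (forall g : {rmorphism K -> K}, g (f s e) = f (g s) (g e)) ->
  z = r^-1 * r ^- n * f s e -> f s e + f (- s) e = 2 * x%:C ->
  complex.Re z = (rootb beta)^-1 * rootb beta ^- n * x.
Proof.
move=> fm zE fx; apply: (@complexI R); rewrite ReJ_add.
have -> : conjc z = r^-1 * r ^- n * f (- s) e.
  rewrite zE -(conj_at_s fm).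
  have cr : conjc r = r by exact: conjc_real.
  transitivity (conjc (r^-1 * r ^- n) * conjc (f s e)); first exact: rmorphM.
  congr (_ * _); transitivity (conjc r^-1 * conjc (r ^- n)); first exact:
    rmorphM.
  have cV : conjc r^-1 = r^-1 by rewrite conjc_inv cr.
  congr (_ * _) => //; rewrite conjc_inv.
  by have -> : conjc (r ^+ n) = r ^+ n by rewrite -{2}cr; exact: rmorphXn.
rewrite zE -mulrDr fx [RHS]rmorphM rmorphM !fmorphV rmorphXn /= mulrCA.
by rewrite mulrAC mulfV ?mul1r // pnatr_eq0.
Qed.

Lemma s2E : s ^+ 2 = S%:C.
Proof. by rewrite sigma2 // rmorphB rmorph1 rmorphXn /= (betaC beta01) -exprM.
  Qed.

Lemma e2E : e ^+ 2 = W%:C.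
Proof. by rewrite /e0 rmorphXn. Qed.

Lemma rmorph_bautin_poly (x y : R) :
  (bautin_poly x y)%:C = bautin_poly x%:C y%:C.
Proof. by rewrite /bautin_poly; ring. Qed.

Lemma rmorph_second_poly (x y : R) :
  (second_poly x y)%:C = second_poly x%:C y%:C.
Proof. by rewrite /second_poly; ring. Qed.

Lemma Re_G21 : complex.Re (G21 beta alpha) =
  (rootb beta)^-1 * rootb beta ^- 4 *
  (alpha * beta ^+ 2 * S * bautin_poly S W / ((W - S) * (4 * W - S))).
Proof.
apply: (@real_part 4 _ (@g21 K) _ _ (G21E beta01 alpha_gt0)) => [g|]; first
  exact: rmorph_g21.
have [[[[[[[s0 e0] p1] m1] p2] m2] p3] m3] := denominators_neq0 beta01
  alpha_gt0.
rewrite g21_sym; try assumption.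
rewrite s2E e2E fmorph_div; congr (2 * (_ / _)); last by ring.
rewrite [RHS]rmorphM [X in _ = _ * X]rmorph_bautin_poly; congr (_ * _).
by rewrite rmorphM.
Qed.

Lemma Re_G32 : complex.Re (G32 beta alpha) =
  (rootb beta)^-1 * rootb beta ^- 8 *
  (alpha * beta ^+ 2 * second_poly S W
   / (3 * (W - S) ^+ 3 * (4 * W - S) ^+ 3 * (4 * W - 9 * S))).
Proof.
apply: (@real_part 8 _ (@g32 K) _ _ (G32E beta01 alpha_gt0)) => [g|]; first
  exact: rmorph_g32.
have [[[[[[[s0 e0] p1] m1] p2] m2] p3] m3] := denominators_neq0 beta01
  alpha_gt0.
rewrite g32_sym; try assumption.
rewrite s2E e2E; congr (2 * _); apply/esym; rewrite fmorph_div.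
rewrite [X in X / _]rmorphM [X in _ * X / _]rmorph_second_poly.
congr (_ / _); ring.
Qed.

End RealParts.

(** * The common zero of the two coefficients *)

Definition critical_poly (K : comNzRingType) (t : K) : K :=
   - 459 * t ^+ 10 - (4 * 1000 + 410) * t ^+ 9 - (7 * 1000 + 563) * t ^+ 8 +
   (60 * 1000 + 598) * t ^+ 7 + (321 * 1000 + 811) * t ^+ 6 + (587 * 1000 +
   106) * t ^+ 5 + (349 * 1000 + 135) * t ^+ 4 - (115 * 1000 + 478) * t ^+ 3
   - (115 * 1000 + 308) * t ^+ 2 - (25 * 1000 + 128) * t - (1000 + 728).

Section BautinCurve.
Variable R : rcfType.
Implicit Types t U W : R.

(** In U = S + 1 the equation reads W^2 + W = 5 U^2 - 3 U, a conic through the origin. The line W =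
    t U meets it in one further point, found by cancelling U. *)
Lemma bautin_curveP U W : 0 < U < 1 -> 0 < W -> bautin_poly (U - 1) W = 0 ->
  exists2 t, 0 < t < 1 & U * (5 - t ^+ 2) = 3 + t /\ W = t * U.
Proof.
case/andP=> U0 U1 W0; rewrite /bautin_poly => P0.
have Un : U != 0 by rewrite gt_eqF.
pose t := W / U; have WE : W = t * U by rewrite /t mulfVK.
have t0 : 0 < t by rewrite divr_gt0.
have tE : U * (5 - t ^+ 2) = 3 + t.
  by apply: (mulfI Un); move: P0; rewrite WE => P0; lra.
exists t => //; rewrite t0 /= ltNge; apply/negP => t1.
(* U < 1 gives 3 + t < 5 - t^2, that is t^2 + t < 2, which fails for t >= 1. *)
have d0 : 0 < 5 - t ^+ 2 by rewrite -(pmulr_rgt0 _ U0) tE; lra.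
have : U * (5 - t ^+ 2) < 5 - t ^+ 2 by rewrite gtr_pMl.
nra.
Qed.

Lemma bautin_curve t : 5 - t ^+ 2 != 0 ->
  bautin_poly ((3 + t) / (5 - t ^+ 2) - 1) (t * ((3 + t) / (5 - t ^+ 2))) = 0.
Proof. by move=> d0; rewrite /bautin_poly; field. Qed.

Lemma second_poly_curve t : 5 - t ^+ 2 != 0 ->
  second_poly ((3 + t) / (5 - t ^+ 2) - 1) (t * ((3 + t) / (5 - t ^+ 2))) =
  12 * (t - 1) * (t + 2) * (t + 3) ^+ 2 * (t + 1) ^+ 2 / (5 - t ^+ 2) ^+ 9
  * critical_poly t.
Proof. by move=> d0; rewrite /second_poly /critical_poly; field. Qed.

(** The root to 24 decimals, enough to determine twenty decimals of beta, alpha and eps_c. *)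
Definition t_lo : R :=
   (((((((545 * 1000 + 342) * 1000 + 149) * 1000 + 695) * 1000 + 96) * 1000 +
   172) * 1000 + 720) * 1000 + 10) / 1000 ^+ 8.

Definition t_hi : R :=
   (((((((545 * 1000 + 342) * 1000 + 149) * 1000 + 695) * 1000 + 96) * 1000 +
   172) * 1000 + 720) * 1000 + 11) / 1000 ^+ 8.

Lemma critical_lo : critical_poly t_lo < 0.
Proof. by rewrite /critical_poly /t_lo; lra. Qed.

Lemma critical_hi : 0 < critical_poly t_hi.
Proof. by rewrite /critical_poly /t_hi; lra. Qed.

(** Being defined over any commutative ring, [critical_poly] can be evaluated at 'X; the result is a
    formal polynomial, to which the intermediate value theorem applies. *)
Lemma horner_critical_poly t :
  (critical_poly ('X : {poly R})).[t] = critical_poly t.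
Proof.
rewrite -horner_evalE.
have -> : horner_eval t (critical_poly 'X) = critical_poly (horner_eval t 'X).
  by rewrite /critical_poly; ring.
by rewrite horner_evalE hornerX.
Qed.

Lemma critical_root : exists2 t, t_lo < t < t_hi & critical_poly t = 0.
Proof.
have lohi : t_lo <= t_hi by rewrite /t_lo /t_hi; lra.
have [|t /andP[lo hi] /rootP] :=
  @poly_ivt R (critical_poly 'X) t_lo t_hi lohi.
  by rewrite !horner_critical_poly (ltW critical_lo) (ltW critical_hi).
rewrite horner_critical_poly => t0; exists t => //.
rewrite !lt_neqAle lo hi !andbT; apply/andP; split; apply/eqP => E.
  by have := critical_lo; rewrite E t0 ltxx.
by have := critical_hi; rewrite -E t0 ltxx.
Qed.

(** In t itself the coefficients of [critical_poly] change sign twice. The substitution t = y / (1 +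
    y) maps the positive half line onto the interval (0, 1) and leaves one change; the leading
    coefficient in y is the value 2^20 of [critical_poly] at 1. *)
Let neg_part (y : R) :=
  ((7 * 1000 + 147) * 1000 + 932) * y ^+ 6 + ((9 * 1000 + 801) * 1000 + 954)
  * y ^+ 5 + ((6 * 1000 + 161) * 1000 + 467) * y ^+ 4 + ((2 * 1000 + 149) *
  1000 + 910) * y ^+ 3 + (419 * 1000 + 220) * y ^+ 2 + (42 * 1000 + 408) * y
  + (1 * 1000 + 728).

Let pos_part (y : R) :=
  ((1 * 1000 + 48) * 1000 + 576) * y ^+ 3 + ((4 * 1000 + 505) * 1000 + 600) *
  y ^+ 2 + ((6 * 1000 + 577) * 1000 + 152) * y + ((1 * 1000 + 384) * 1000 +
  512).

Let critical_polyE y : 1 + y != 0 ->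
  critical_poly (y / (1 + y)) * (1 + y) ^+ 10
  = y ^+ 7 * pos_part y - neg_part y.
Proof.
by move=> y1; rewrite /critical_poly /pos_part /neg_part; field.
Qed.

(* In y = t / (1 - t) the coefficients have a single sign change, between y^6
   and y^7, so that the quotient by y^7 is strictly increasing for y > 0. *)
Let critical_root_lt_false (y1 y2 : R) : 0 < y1 -> y1 < y2 ->
  y1 ^+ 7 * pos_part y1 = neg_part y1 -> y2 ^+ 7 * pos_part y2 = neg_part y2 ->
  False.
Proof.
move=> y10 y12 E1 E2; have y20 := lt_trans y10 y12.
have mon k : y1 ^+ k <= y2 ^+ k by rewrite lerXn2r ?nnegrE ?ltW.
have posle : pos_part y1 <= pos_part y2.
  by rewrite /pos_part; have := mon 1; have := mon 2; have := mon 3; lra.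
have negk k : (k <= 7)%N -> y2 ^+ k * y1 ^+ 7 <= y1 ^+ k * y2 ^+ 7.
  move=> k7; rewrite -(subnKC k7) !exprD mulrA [leLHS]mulrC [leRHS]mulrA.
  rewrite -[leLHS]mulrC [y2 ^+ k * _]mulrC ler_wpM2l ?mon //.
  by rewrite mulr_ge0 // exprn_ge0 // ltW.
have neglt : neg_part y2 * y1 ^+ 7 < neg_part y1 * y2 ^+ 7.
  (* The inequalities [negk] are weak; strictness comes from the constant coefficient of
     [neg_part]. *)
  have y7 : y1 ^+ 7 < y2 ^+ 7 by rewrite ltrXn2r ?nnegrE ?ltW.
  have := negk 1 isT; have := negk 2 isT; have := negk 3 isT.
  have := negk 4 isT; have := negk 5 isT; have := negk 6 isT.
  rewrite /neg_part; lra.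
move: neglt; rewrite -E1 -E2; apply/negP; rewrite -leNgt.
rewrite mulrAC [leRHS]mulrAC [y2 ^+ 7 * _]mulrC ler_wpM2l //.
by rewrite mulr_ge0 // exprn_ge0 // ltW.
Qed.

Lemma critical_root_unique t t' : 0 < t < 1 -> 0 < t' < 1 ->
  critical_poly t = 0 -> critical_poly t' = 0 -> t = t'.
Proof.
have key (a b : R) : 0 < a < 1 -> 0 < b < 1 -> a < b ->
    critical_poly a = 0 -> critical_poly b = 0 -> False.
  move=> /andP[a0 a1] /andP[b0 b1] ab A0 B0.
  have yP (u : R) : 0 < u -> u < 1 -> critical_poly u = 0 ->
      (u / (1 - u)) ^+ 7 * pos_part (u / (1 - u)) = neg_part (u / (1 - u)).
    move=> u0 u1 U0; have d0 : 1 - u != 0 by lra.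
    have y0 : 1 + u / (1 - u) != 0.
      by rewrite (_ : _ + _ = (1 - u)^-1) ?invr_eq0 //; field.
    apply/eqP; rewrite -subr_eq0 -critical_polyE //.
    rewrite (_ : u / (1 - u) / _ = u) ?U0 ?mul0r //; field.
    by rewrite d0 /= (_ : _ + _ = 1) ?oner_eq0 //; ring.
  apply: (critical_root_lt_false _ _ (yP a a0 a1 A0) (yP b b0 b1 B0)).
    by rewrite divr_gt0 // subr_gt0.
  by rewrite ltr_pdivrMr ?subr_gt0 // mulrAC ltr_pdivlMr ?subr_gt0 //; nra.
move=> t01 t'01 T0 T'0; apply/eqP; case: ltrgtP => // tt'.
  by case: (key t t').
by case: (key t' t).
Qed.

End BautinCurve.

(** * Transversality along a curve *)

Section Differentiability.
Local Open Scope classical_set_scope.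
Variables (R : realType) (V : normedModType R).
Implicit Types (f g : V -> R) (x : V).

(** The closed formulas for l1 and l2 hold only for 0 < beta < 1 and alpha > 0, so differentiability
    has to be transferred along a local equality. The first-order expansion of f serves for g. *)
Lemma near_eq_differentiable f g x :
  (\near x, f x = g x) -> differentiable f x -> differentiable g x.
Proof.
move=> fg /diff_locallyP[df_cont fE].
have gE : g \o shift x = cst (g x) + 'd f x +o_ 0 id.
  apply/eqaddoP => eps eps0; move/eqaddoP: fE => /(_ eps eps0).
  have fgx : f x = g x := nbhs_singleton fg.
  have fg0 : \forall h \near 0, f (x + h) = g (x + h) by move/nbhs0P: fg.
  apply: filterS2 fg0 => h /= fgh.
  by rewrite !fctE /= [h + x]addrC fgh fgx.
by apply/diff_locallyP; rewrite (diff_unique df_cont gE).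
Qed.

(** The calculus rules are restated for functions written pointwise, the shape that the explicit
    formulas have. *)
Lemma differentiable_fun_cst (c : R) x : differentiable (fun _ : V => c) x.
Proof. exact: differentiable_cst. Qed.

Lemma differentiable_funD f g x : differentiable f x -> differentiable g x ->
  differentiable (fun y => f y + g y) x.
Proof. exact: differentiableD. Qed.

Lemma differentiable_funN f x : differentiable f x ->
  differentiable (fun y => - f y) x.
Proof. exact: differentiableN. Qed.

Lemma differentiable_funM f g x : differentiable f x -> differentiable g x ->
  differentiable (fun y => f y * g y) x.
Proof. exact: differentiableM. Qed.

Lemma differentiable_funX f n x : differentiable f x ->
  differentiable (fun y => f y ^+ n) x.
Proof.
move=> df; elim: n => [|n IH]; first exact: differentiable_cst.
rewrite (_ : (fun _ => _) = (fun y => f y * f y ^+ n)).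
  exact: differentiable_funM.
by apply/funext => y; rewrite exprS.
Qed.

Lemma differentiable_funV f x : differentiable f x -> f x != 0 ->
  differentiable (fun y => (f y)^-1) x.
Proof. by move=> df fx; exact: differentiableV. Qed.

Lemma differentiable_fun_sqrt f x : differentiable f x -> 0 < f x ->
  differentiable (fun y => Num.sqrt (f y)) x.
Proof.
move=> df fx; apply: (@differentiable_comp _ _ _ _ f Num.sqrt) => //.
by apply/derivable1_diffP; have [] := is_derive1_sqrt fx.
Qed.

Lemma is_derive_fun_cst (c : R) x v : is_derive x v (fun _ : V => c) 0.
Proof. exact: is_derive_cst. Qed.

Lemma is_derive_funD f g x v df dg : is_derive x v f df ->
  is_derive x v g dg -> is_derive x v (fun y => f y + g y) (df + dg).
Proof. exact: is_deriveD. Qed.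

Lemma is_derive_funN f x v df : is_derive x v f df ->
  is_derive x v (fun y => - f y) (- df).
Proof. exact: is_deriveN. Qed.

Lemma is_derive_funM f g x v df dg : is_derive x v f df ->
  is_derive x v g dg ->
  is_derive x v (fun y => f y * g y) (f x * dg + g x * df).
Proof. exact: is_deriveM. Qed.

Lemma is_derive_funX2 f x v df : is_derive x v f df ->
  is_derive x v (fun y => f y ^+ 2) (2 * f x * df).
Proof.
move=> fD; apply: (is_derive_eq (is_derive_funM fD fD)).
by rewrite -mulrDl mulr_natl mulr2n.
Qed.

End Differentiability.

Section TransversalAlongCurve.
Local Open Scope classical_set_scope.
Variable R : realType.
Implicit Types (f g : 'cV[R]_2 -> R) (gamma : R -> 'cV[R]_2).

Lemma gradient_mul f m v : differentiable f m ->
  gradient f m *m v = ('d f m v)%:M.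
Proof.
move=> df; have vE : v = \sum_j v j 0 *: delta_mx j 0.
  apply/colP => i; rewrite summxE (bigD1 i) //= !mxE !eqxx mulr1.
  by rewrite big1 ?addr0 // => j ji; rewrite !mxE eq_sym (negbTE ji) mulr0.
apply/matrixP => i j; rewrite !ord1 !mxE eqxx mulr1n [in RHS]vE linear_sum /=.
by apply: eq_bigr => k _; rewrite linearZ /= !mxE /partial deriveE // mulrC.
Qed.

Lemma derive_along f gamma t : differentiable gamma t ->
  differentiable f (gamma t) ->
  'D_1 (f \o gamma) t = 'd f (gamma t) ('d gamma t 1).
Proof.
move=> dg df; have dfg := differentiable_comp dg df.
by rewrite (deriveE _ dfg) (diff_comp dg df).
Qed.

(** A linear relation between the gradients is applied to the tangent vector of the curve. The
    gradient of f vanishes on it and that of g does not, so the coefficient of g is zero; the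
    nonzero entry j then annihilates the coefficient of f. *)
Lemma transversal_along_curve f g gamma t j :
  differentiable gamma t -> differentiable f (gamma t) ->
  differentiable g (gamma t) -> 'D_1 (f \o gamma) t = 0 ->
  'D_1 (g \o gamma) t != 0 -> partial j f (gamma t) != 0 ->
  transversal_at f g (gamma t).
Proof.
move=> dgamma df dg; rewrite !derive_along // => f0 g0 pf; split=> //.
set M := col_mx _ _; rewrite -kermx_eq0; apply/rowV0P => w /sub_kermxP wM.
rewrite -[w]hsubmxK mul_row_col in wM.
set c1 := lsubmx w in wM *; set c2 := rsubmx w in wM *.
have c2E : c2 = 0.
  have := congr1 (mulmx^~ ('d gamma t 1)) wM; rewrite mulmxDl mul0mx -!mulmxA.
  rewrite !gradient_mul // f0 raddf0 mulmx0 add0r mul_mx_scalar.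
  by move=> /eqP; rewrite scaler_eq0 (negbTE g0) => /eqP.
have c1E : c1 = 0.
  move: wM; rewrite c2E mul0mx addr0 => /matrixP/(_ 0 j).
  rewrite !mxE big_ord1 !mxE => /eqP; rewrite mulf_eq0 (negbTE pf) orbF.
  by move=> /eqP c0; apply/matrixP => a b; rewrite !ord1 /c1 !mxE.
by rewrite -[w]hsubmxK -/c1 -/c2 c1E c2E row_mx0.
Qed.

End TransversalAlongCurve.

(** * The curve of zeros of the first coefficient *)

Definition critical_deriv (K : comNzRingType) (t : K) : K :=
   - (4 * 1000 + 590) * t ^+ 9 - (39 * 1000 + 690) * t ^+ 8 - (60 * 1000 +
   504) * t ^+ 7 + (424 * 1000 + 186) * t ^+ 6 + ((1000 + 930) * 1000 + 866)
   * t ^+ 5 + ((2 * 1000 + 935) * 1000 + 530) * t ^+ 4 + ((1000 + 396) * 1000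
   + 540) * t ^+ 3 - (346 * 1000 + 434) * t ^+ 2 - (230 * 1000 + 616) * t -
   (25 * 1000 + 128).

Section CriticalPoint.
Variable R : realType.
Implicit Types t beta alpha : R.

Lemma is_derive_horner_step (c : R) (f : R -> R) df t :
  is_derive t 1 f df -> is_derive t 1 (fun x => x * f x + c) (f t + t * df).
Proof.
move=> fD; have H := is_deriveD (is_deriveM (is_derive_id t 1) fD)
  (is_derive_cst c t 1).
by apply: (is_derive_eq H); rewrite /GRing.scale /=; ring.
Qed.

Lemma is_derive_critical t :
  is_derive t 1 (@critical_poly R) (critical_deriv t).
Proof.
have -> : @critical_poly R = fun x =>
    x * (x * (x * (x * (x * (x * (x * (x * (x * (x * (- 459) + (- (4 * 1000 +
    410))) + (- (7 * 1000 + 563))) + (60 * 1000 + 598)) + (321 * 1000 + 811))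
    + (587 * 1000 + 106)) + (349 * 1000 + 135)) + (- (115 * 1000 + 478))) +
    (- (115 * 1000 + 308))) + (- (25 * 1000 + 128))) + (- (1 * 1000 + 728)).
  by apply/funext => x; rewrite /critical_poly; ring.
have step := is_derive_horner_step.
have base (c : R) : is_derive t 1 (fun=> c) 0 by exact: is_derive_cst.
have H :=
  step (- (1 * 1000 + 728)) _ _ t (step (- (25 * 1000 + 128)) _ _ t (step (-
  (115 * 1000 + 308)) _ _ t (step (- (115 * 1000 + 478)) _ _ t (step (349 *
  1000 + 135) _ _ t (step (587 * 1000 + 106) _ _ t (step (321 * 1000 + 811) _
  _ t (step (60 * 1000 + 598) _ _ t (step (- (7 * 1000 + 563)) _ _ t (step (-
  (4 * 1000 + 410)) _ _ t (base (- 459))))))))))).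
by apply: (is_derive_eq H); rewrite /critical_deriv /=; ring.
Qed.

(** Two decimals of t suffice: powers with positive coefficients are bounded below at 54/100, those
    with negative coefficients above at 55/100, and the rest is linear. *)
Lemma critical_deriv_gt0 t : t_lo R < t < t_hi R -> 0 < critical_deriv t.
Proof.
move=> /andP[lo hi].
have l : 54 / 100 <= t by apply: le_trans (ltW lo); rewrite /t_lo; lra.
have h : t <= 55 / 100 by apply: le_trans (ltW hi) _; rewrite /t_hi; lra.
have lk k : (54 / 100) ^+ k <= t ^+ k by rewrite lerXn2r ?nnegrE //; lra.
have hk k : t ^+ k <= (55 / 100) ^+ k by rewrite lerXn2r ?nnegrE //; lra.
have := hk 2; have := hk 8; have := hk 9; have := lk 3; have := lk 4.
have := lk 5; have := lk 6; have := lk 7; have := hk 7.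
rewrite /critical_deriv; lra.
Qed.

Definition beta_sq t := (3 + t) / (5 - t ^+ 2).
Definition beta_of t := Num.sqrt (beta_sq t).
(** With U = beta^2, the relations W = alpha^2 U^2 and W = t U give alpha^2 = t / U. *)
Definition alpha_of t := Num.sqrt (t / beta_sq t).

Section Curve.
Variable t : R.
Hypothesis t01 : 0 < t < 1.

Let t_gt0 : 0 < t. Proof. by case/andP: t01. Qed.
Let t_lt1 : t < 1. Proof. by case/andP: t01. Qed.

Lemma curve_den_gt0 : 0 < 5 - t ^+ 2.
Proof. by move: t_gt0 t_lt1; nra. Qed.

Lemma beta_sq_gt0 : 0 < beta_sq t.
Proof. by rewrite divr_gt0 ?curve_den_gt0 // addr_gt0. Qed.

Lemma beta_sq_lt1 : beta_sq t < 1.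
Proof.
rewrite ltr_pdivrMr ?curve_den_gt0 // mul1r; move: t_gt0 t_lt1; nra.
Qed.

Lemma beta_of2 : beta_of t ^+ 2 = beta_sq t.
Proof. by rewrite sqr_sqrtr // ltW // beta_sq_gt0. Qed.

Lemma alpha_of2 : alpha_of t ^+ 2 = t / beta_sq t.
Proof. by rewrite sqr_sqrtr // ltW // divr_gt0 // beta_sq_gt0. Qed.

Lemma beta_of01 : 0 < beta_of t < 1.
Proof.
rewrite sqrtr_gt0 beta_sq_gt0 /= -[ltRHS]sqrtr1 ltr_sqrt ?beta_sq_lt1 //.
Qed.

Lemma alpha_of_gt0 : 0 < alpha_of t.
Proof. by rewrite sqrtr_gt0 divr_gt0 // beta_sq_gt0. Qed.

Lemma curve_W : (alpha_of t * beta_of t ^+ 2) ^+ 2 = t * beta_sq t.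
Proof.
rewrite exprMn alpha_of2 beta_of2; field.
by rewrite gt_eqF // beta_sq_gt0.
Qed.

End Curve.

(** The prefactors are separated because only their differentiability and their nonvanishing matter
    at a zero of the polynomials. *)
Definition prefactor1 beta alpha : R :=
  let S := beta ^+ 2 - 1 in let W := (alpha * beta ^+ 2) ^+ 2 in
  2^-1 * ((Num.sqrt beta)^-1 * (Num.sqrt beta ^+ 4)^-1)
  * (alpha * beta ^+ 2 * S) * ((W - S) * (4 * W - S))^-1.

Definition prefactor2 beta alpha : R :=
  let S := beta ^+ 2 - 1 in let W := (alpha * beta ^+ 2) ^+ 2 in
  12^-1 * ((Num.sqrt beta)^-1 * (Num.sqrt beta ^+ 8)^-1)
  * (alpha * beta ^+ 2)
  * (3 * (W - S) ^+ 3 * (4 * W - S) ^+ 3 * (4 * W - 9 * S))^-1.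

(** * Closed formulas for the two Lyapunov coefficients *)

Section Formulas.
Variables beta alpha : R.
Hypotheses (beta01 : 0 < beta < 1) (alpha_gt0 : 0 < alpha).
Let S := beta ^+ 2 - 1.
Let W := (alpha * beta ^+ 2) ^+ 2.

Lemma l1E : l1 beta alpha = prefactor1 beta alpha * bautin_poly S W.
Proof.
rewrite /l1 Re_G21 // /prefactor1 -/S -/W /rootb.
by move: (bautin_poly S W) ((_ * (4 * W - S))^-1) => P d; ring.
Qed.

Lemma l2E : l2 beta alpha = prefactor2 beta alpha * second_poly S W.
Proof.
rewrite /l2 Re_G32 // /prefactor2 -/S -/W /rootb.
by move: (second_poly S W) ((_ * (4 * W - 9 * S))^-1) => P d; ring.
Qed.

Let beta_gt0 : 0 < beta. Proof. by case/andP: beta01. Qed.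

Lemma S_lt0 : S < 0.
Proof. by case/andP: beta01 => b0 b1; rewrite subr_lt0 expr_lt1 // ltW. Qed.

Lemma W_gt0 : 0 < W.
Proof. by rewrite exprn_gt0 // mulr_gt0 // exprn_gt0. Qed.

Lemma prefactor_dens : [/\ 0 < W - S, 0 < 4 * W - S & 0 < 4 * W - 9 * S].
Proof. by have := S_lt0; have := W_gt0; move=> W0 S0; split; lra. Qed.

Lemma prefactor1_neq0 : prefactor1 beta alpha != 0.
Proof.
have [d1 d2 d3] := prefactor_dens; have s0 := S_lt0.
rewrite /prefactor1 -/S -/W.
repeat first [apply: mulf_neq0 | apply: invr_neq0 | apply: expf_neq0];
  first [by rewrite pnatr_eq0 | by rewrite gt_eqF // ?sqrtr_gt0 | by rewrite
    lt_eqF].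
Qed.

Lemma prefactor2_neq0 : prefactor2 beta alpha != 0.
Proof.
have [d1 d2 d3] := prefactor_dens.
rewrite /prefactor2 -/S -/W.
repeat first [apply: mulf_neq0 | apply: invr_neq0 | apply: expf_neq0];
  first [by rewrite pnatr_eq0 | by rewrite gt_eqF // ?sqrtr_gt0 | by rewrite
    lt_eqF].
Qed.

End Formulas.

End CriticalPoint.

(** * Decimal digits *)

Section Digits.
Variables (R : realType) (t : R).
Hypothesis t_in : t_lo R < t < t_hi R.

Let lo : t_lo R < t. Proof. by case/andP: t_in. Qed.
Let hi : t < t_hi R. Proof. by case/andP: t_in. Qed.

Lemma near_critical01 : 0 < t < 1.
Proof.
apply/andP; split; first by apply: le_lt_trans lo; rewrite /t_lo; lra.
by apply: lt_le_trans hi _; rewrite /t_hi; lra.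
Qed.

Let powers k : t_lo R ^+ k.+1 < t ^+ k.+1 < t_hi R ^+ k.+1.
Proof.
have l0 : 0 <= t_lo R by rewrite /t_lo; lra.
by rewrite !ltrXn2r ?nnegrE // ltW // (le_lt_trans l0).
Qed.

Lemma lt_of_sqr (x y : R) : 0 <= x -> 0 <= y -> x ^+ 2 < y ^+ 2 -> x < y.
Proof. by move=> x0 y0; rewrite ltr_pXn2r // nnegrE. Qed.

Definition beta_lo : R :=
   (((((((868 * 1000 + 280) * 1000 + 339) * 1000 + 979) * 1000 + 712) * 1000
   + 815) * 1000 + 428) * 1000 + 244) / 1000 ^+ 8.

Definition beta_hi : R :=
   (((((((868 * 1000 + 280) * 1000 + 339) * 1000 + 979) * 1000 + 712) * 1000
   + 815) * 1000 + 428) * 1000 + 245) / 1000 ^+ 8.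

Definition alpha_lo : R :=
   ((((((850 * 1000 + 500) * 1000 + 484) * 1000 + 306) * 1000 + 850) * 1000 +
   178) * 1000 + 563) / 1000 ^+ 7.

Definition alpha_hi : R :=
   ((((((850 * 1000 + 500) * 1000 + 484) * 1000 + 306) * 1000 + 850) * 1000 +
   178) * 1000 + 564) / 1000 ^+ 7.

Definition eps_lo : R :=
   (((((((1 * 1000 + 376) * 1000 + 241) * 1000 + 64) * 1000 + 846) * 1000 +
   599) * 1000 + 531) * 1000 + 718) / 1000 ^+ 7.

Definition eps_hi : R :=
   (((((((1 * 1000 + 376) * 1000 + 241) * 1000 + 64) * 1000 + 846) * 1000 +
   599) * 1000 + 531) * 1000 + 719) / 1000 ^+ 7.

Let dec_ge0 : [/\ 0 <= beta_lo, 0 <= beta_hi, 0 <= alpha_lo, 0 <= alpha_hi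
  & 0 <= eps_lo /\ 0 <= eps_hi].
Proof.
by rewrite /beta_lo /beta_hi /alpha_lo /alpha_hi /eps_lo /eps_hi;
  do !split; lra.
Qed.

Lemma beta_bounds : beta_lo < beta_of t < beta_hi.
Proof.
have [b0 b1 _ _ _] := dec_ge0; have d0 := curve_den_gt0 near_critical01.
(* [powers 1] bounds the square of t: after squaring and clearing the denominator the goal is linear
   in t and t^2. *)
have /andP[p1 p2] := powers 1; have l := lo; have h := hi.
apply/andP; split; apply: lt_of_sqr; rewrite ?sqrtr_ge0 // beta_of2
  ?near_critical01 //.
  rewrite ltr_pdivlMr //; move: p1 p2 l h.
  rewrite /beta_lo /t_lo /t_hi; lra.
rewrite ltr_pdivrMr //; move: p1 p2 l h.
rewrite /beta_hi /t_lo /t_hi; lra.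
Qed.

Let alpha_sqE : alpha_of t ^+ 2 = t * (5 - t ^+ 2) / (3 + t).
Proof.
have d0 := curve_den_gt0 near_critical01; have /andP[t0 _] := near_critical01.
rewrite alpha_of2 ?near_critical01 // /beta_sq; field.
by rewrite !gt_eqF // addr_gt0.
Qed.

Lemma alpha_bounds : alpha_lo < alpha_of t < alpha_hi.
Proof.
have [_ _ a0 a1 _] := dec_ge0; have /andP[t0 _] := near_critical01.
(* Here t (5 - t^2) calls for the cube of t. *)
have /andP[p1 p2] := powers 2; have l := lo; have h := hi.
have d0 : 0 < 3 + t by rewrite addr_gt0.
apply/andP; split; apply: lt_of_sqr; rewrite ?sqrtr_ge0 // alpha_sqE.
  rewrite ltr_pdivlMr //; move: p1 p2 l h.
  rewrite /alpha_lo /t_lo /t_hi; lra.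
rewrite ltr_pdivrMr //; move: p1 p2 l h.
rewrite /alpha_hi /t_lo /t_hi; lra.
Qed.

Lemma eps_bounds : eps_lo < eps_c (beta_of t) (alpha_of t) < eps_hi.
Proof.
have [b0 b1 _ _ [e0 e1]] := dec_ge0; have /andP[t0 _] := near_critical01.
have /andP[bl bh] := beta_bounds; have l := lo; have h := hi.
have b01 := beta_of01 near_critical01; have a0 := alpha_of_gt0 near_critical01.
have l0 : 0 <= t_lo R by rewrite /t_lo; lra.
have tb1 : t_lo R * beta_lo < t * beta_of t by rewrite ltr_pM.
have tb2 : t * beta_of t < t_hi R * beta_hi.
  by rewrite ltr_pM ?ltW //; case/andP: b01.
(* The square of eps_c is 4 alpha^2 beta^3, and alpha^2 beta^2 = t on the curve. *)
have epsE : eps_c (beta_of t) (alpha_of t) ^+ 2 = 4 * (t * beta_of t).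
  have r6 : (rootb (beta_of t) ^+ 3) ^+ 2 = beta_of t ^+ 2 * beta_of t.
    by rewrite -exprM mulnC exprM rootb2 // exprSr.
  rewrite eps_cE // exprMn exprMn r6 alpha_of2 ?near_critical01 // beta_of2
    ?near_critical01 //.
  have := beta_sq_gt0 near_critical01.
  by move: (beta_sq t) (beta_of t) => u b u0; field; rewrite gt_eqF.
have eps0 : 0 <= eps_c (beta_of t) (alpha_of t).
  by rewrite eps_cE // !mulr_ge0 ?exprn_ge0 ?sqrtr_ge0.
apply/andP; split; apply: lt_of_sqr; rewrite // epsE.
  by move: tb1; rewrite /eps_lo /t_lo /beta_lo; lra.
by move: tb2; rewrite /eps_hi /t_hi /beta_hi; lra.
Qed.

Lemma beta_digits : leading_digits (beta_of t) 0
  [:: 8; 6; 8; 2; 8; 0; 3; 3; 9; 9; 7; 9; 7; 1; 2; 8; 1; 5; 4; 2]%N.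
Proof.
have := beta_bounds; rewrite /leading_digits !big_ord_recl big_ord0 /=.
rewrite /beta_lo /beta_hi => /andP[l h]; apply/andP; split; lra.
Qed.

Lemma alpha_digits : leading_digits (alpha_of t) 0
  [:: 8; 5; 0; 5; 0; 0; 4; 8; 4; 3; 0; 6; 8; 5; 0; 1; 7; 8; 5; 6]%N.
Proof.
have := alpha_bounds; rewrite /leading_digits !big_ord_recl big_ord0 /=.
rewrite /alpha_lo /alpha_hi => /andP[l h]; apply/andP; split; lra.
Qed.

Lemma eps_digits : leading_digits (eps_c (beta_of t) (alpha_of t)) 1
  [:: 3; 7; 6; 2; 4; 1; 0; 6; 4; 8; 4; 6; 5; 9; 9; 5; 3; 1; 7; 1]%N.
Proof.
have := eps_bounds; rewrite /leading_digits !big_ord_recl big_ord0 /=.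
rewrite /eps_lo /eps_hi => /andP[l h]; apply/andP; split; lra.
Qed.

End Digits.

(** * The intersection point *)

Section Transversality.
Local Open Scope classical_set_scope.
Variable R : realType.
Implicit Types (m y : 'cV[R]_2) (t : R).

Definition bautin_curve_point t : 'cV[R]_2 :=
  \col_i [:: beta_of t; alpha_of t]`_i.

Definition in_strip m := 0 < m 0 0 < 1 /\ 0 < m 1 0.

Lemma near_in_strip m : in_strip m -> \near m, in_strip m.
Proof.
move=> [/andP[b0 b1] a0].
have cb : (fun y : 'cV[R]_2 => y 0 0) y @[y --> m] --> m 0 0.
  exact: coord_continuous.
have ca : (fun y : 'cV[R]_2 => y 1 0) y @[y --> m] --> m 1 0.
  exact: coord_continuous.
near=> y; split; first by apply/andP; split; near: y;
  [exact: (cvgr_gt _ cb) | exact: (cvgr_lt _ cb)].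
by near: y; exact: (cvgr_gt _ ca).
Unshelve. all: by end_near. Qed.

Ltac differentiate := repeat first
  [ exact: differentiable_fun_cst | exact: differentiable_coord
  | apply: differentiable_funX | apply: differentiable_funD
  | apply: differentiable_funN | apply: differentiable_funM
  | apply: differentiable_fun_sqrt | apply: differentiable_funV ].

Lemma differentiable_prefactor1 m : in_strip m ->
  differentiable (fun y => prefactor1 (y 0 0) (y 1 0)) m.
Proof.
move=> [m01 m0]; have /andP[b0 _] := m01.
have [d1 d2 d3] := prefactor_dens m01 m0.
rewrite /prefactor1 /=; differentiate => //;
  by rewrite ?expf_neq0 ?mulf_neq0 // ?gt_eqF ?sqrtr_gt0.
Qed.

Lemma differentiable_prefactor2 m : in_strip m ->
  differentiable (fun y => prefactor2 (y 0 0) (y 1 0)) m.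
Proof.
move=> [m01 m0]; have /andP[b0 _] := m01.
have [d1 d2 d3] := prefactor_dens m01 m0.
rewrite /prefactor2 /=; differentiate => //;
  by rewrite ?(mulf_neq0, expf_neq0) ?pnatr_eq0 // ?gt_eqF ?sqrtr_gt0.
Qed.

Let S (y : 'cV[R]_2) := y 0 0 ^+ 2 - 1.
Let W (y : 'cV[R]_2) := (y 1 0 * y 0 0 ^+ 2) ^+ 2.

Let F1 y := prefactor1 (y 0 0) (y 1 0) * bautin_poly (S y) (W y).
Let F2 y := prefactor2 (y 0 0) (y 1 0) * second_poly (S y) (W y).

Lemma near_l1E m : in_strip m -> \forall y \near m, F1 y = on_plane (@l1 R) y.
Proof.
move=> /near_in_strip; apply: filterS => y [y01 y0].
by rewrite /on_plane l1E.
Qed.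

Lemma near_l2E m : in_strip m -> \forall y \near m, F2 y = on_plane (@l2 R) y.
Proof.
move=> /near_in_strip; apply: filterS => y [y01 y0].
by rewrite /on_plane l2E.
Qed.

Lemma differentiable_l1 m : in_strip m ->
  differentiable (on_plane (@l1 R)) m.
Proof.
move=> ms; apply: near_eq_differentiable (near_l1E ms) _.
apply: differentiable_funM; first exact: differentiable_prefactor1.
by rewrite /bautin_poly /S /W; differentiate.
Qed.

Lemma differentiable_l2 m : in_strip m ->
  differentiable (on_plane (@l2 R)) m.
Proof.
move=> ms; apply: near_eq_differentiable (near_l2E ms) _.
apply: differentiable_funM; first exact: differentiable_prefactor2.
by rewrite /second_poly /S /W; differentiate.
Qed.

(** At a zero of [bautin_poly] the derivative of the prefactor drops out. The polynomial depends on
    alpha through W alone, and both its W-derivative 2 W + 1 and the alpha-derivative of W are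
    positive. *)
Lemma partial_alpha_l1_neq0 m : in_strip m -> bautin_poly (S m) (W m) = 0 ->
  partial 1 (on_plane (@l1 R)) m != 0.
Proof.
move=> ms P0; have [m01 m0] := ms; have /andP[b0 _] := m01.
rewrite /partial -(near_eq_derive _ (near_l1E ms)).
pose F y := prefactor1 (y 0 0) (y 1 0); pose v : 'cV[R]_2 := delta_mx 1 0.
have db : is_derive m v (fun y : 'cV[R]_2 => y 0 0) 0.
  by have := is_derive_coord 0 m v; rewrite mxE.
have da : is_derive m v (fun y : 'cV[R]_2 => y 1 0) 1.
  by have := is_derive_coord 1 m v; rewrite mxE.
have dS : is_derive m v S 0.
  apply: is_derive_eq (is_derive_funD (is_derive_funX2 db)
    (is_derive_fun_cst (- 1) m v)) _; ring.
have dW : is_derive m v W (2 * m 1 0 * m 0 0 ^+ 4).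
  apply: is_derive_eq
    (is_derive_funX2 (is_derive_funM da (is_derive_funX2 db))) _.
  ring.
have cst c := is_derive_fun_cst c m v.
have dP : is_derive m v (fun y => bautin_poly (S y) (W y))
    ((2 * W m + 1) * (2 * m 1 0 * m 0 0 ^+ 4)).
  apply: is_derive_eq (is_derive_funD (is_derive_funD (is_derive_funD
    (is_derive_funD (is_derive_funX2 dW) dW)
    (is_derive_funN (is_derive_funM (cst 5) (is_derive_funX2 dS))))
    (is_derive_funN (is_derive_funM (cst 7) dS))) (cst (- 2))) _.
  ring.
have dF : is_derive m v F ('D_v F m).
  by apply: derivableP; apply: diff_derivable; exact: differentiable_prefactor1.
have [_ ->] := is_derive_funM dF dP.
rewrite P0 mul0r addr0 mulf_neq0 //; first exact: prefactor1_neq0.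
have W0 := W_gt0 m01 m0.
by rewrite gt_eqF // !mulr_gt0 ?exprn_gt0 // addr_gt0 // mulr_gt0.
Qed.

Lemma differentiable_fun_id (t : R) : differentiable (fun u : R => u) t.
Proof. exact: ex_diff. Qed.

Ltac differentiate1 := repeat first
  [ exact: differentiable_fun_cst | exact: differentiable_fun_id
  | apply: differentiable_funX | apply: differentiable_funD
  | apply: differentiable_funN | apply: differentiable_funM
  | apply: differentiable_fun_sqrt | apply: differentiable_funV ].

Lemma differentiable_bautin_curve_point t : 0 < t < 1 ->
  differentiable bautin_curve_point t.
Proof.
move=> t01; have d0 := curve_den_gt0 t01; have b0 := beta_sq_gt0 t01.
have /andP[t0 _] := t01.
have db : differentiable (@beta_sq R) t.
  by rewrite /beta_sq; differentiate1 => //; rewrite gt_eqF.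
apply/derivable1_diffP/derivable_mxP => i j; apply/derivable1_diffP.
rewrite {}(ord1 j); case: i => -[|[|//]] lt2.
  rewrite (_ : (fun x => _) = @beta_of R); last first.
    by apply/funext => u; rewrite mxE.
  exact: differentiable_fun_sqrt.
rewrite (_ : (fun x => _) = @alpha_of R); last first.
  by apply/funext => u; rewrite mxE.
apply: differentiable_fun_sqrt; last by rewrite divr_gt0.
by differentiate1 => //; rewrite gt_eqF.
Qed.

Lemma bautin_curve_in_strip t : 0 < t < 1 -> in_strip (bautin_curve_point t).
Proof.
by move=> t01; split; rewrite !mxE /= ?beta_of01 ?alpha_of_gt0.
Qed.

Definition curve_factor t : R :=
  12 * (t - 1) * (t + 2) * (t + 3) ^+ 2 * (t + 1) ^+ 2 / (5 - t ^+ 2) ^+ 9.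

Lemma l1_on_curve t : 0 < t < 1 -> l1 (beta_of t) (alpha_of t) = 0.
Proof.
move=> t01; rewrite l1E ?beta_of01 ?alpha_of_gt0 // curve_W // beta_of2 //.
by rewrite bautin_curve ?mulr0 // gt_eqF // curve_den_gt0.
Qed.

Lemma l2_on_curve t : 0 < t < 1 -> l2 (beta_of t) (alpha_of t) =
  prefactor2 (beta_of t) (alpha_of t) * curve_factor t * critical_poly t.
Proof.
move=> t01; rewrite l2E ?beta_of01 ?alpha_of_gt0 // curve_W // beta_of2 //.
by rewrite second_poly_curve ?mulrA // gt_eqF // curve_den_gt0.
Qed.

Lemma curve_factor_neq0 t : 0 < t < 1 -> curve_factor t != 0.
Proof.
move=> t01; have d0 := curve_den_gt0 t01; have /andP[t0 t1] := t01.
rewrite /curve_factor !mulf_neq0 ?invr_eq0 ?expf_neq0 ?pnatr_eq0 //;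
  by [rewrite gt_eqF // ?addr_gt0 | rewrite subr_eq0 lt_eqF].
Qed.

Lemma transversal_on_curve t : t_lo R < t < t_hi R -> critical_poly t = 0 ->
  transversal_at (on_plane (@l1 R)) (on_plane (@l2 R)) (bautin_curve_point t).
Proof.
move=> t_in t0; have t01 := near_critical01 t_in; have ms :=
  bautin_curve_in_strip t01.
have near01 : \forall u \near t, 0 < u < 1.
  have /andP[t_gt0 t_lt1] := t01; near=> u; apply/andP; split; near: u.
    exact: (cvgr_gt t cvg_id).
  exact: (cvgr_lt t cvg_id).
have dgamma := differentiable_bautin_curve_point t01.
apply: (@transversal_along_curve _ _ _ _ _ 1) => //.
- exact: differentiable_l1.
- exact: differentiable_l2.
- rewrite -[RHS](derive_cst 0 t 1); apply: near_eq_derive.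
  apply: filterS near01 => u u01; rewrite /= /on_plane !mxE /=.
  exact: l1_on_curve.
- pose G u := prefactor2 (beta_of u) (alpha_of u) * curve_factor u.
  have near2 : \forall u \near t,
      G u * critical_poly u = (on_plane (@l2 R) \o bautin_curve_point) u.
    apply: filterS near01 => u u01; rewrite /= /on_plane !mxE /=.
    by rewrite l2_on_curve.
  rewrite -(near_eq_derive _ near2).
  have dG : differentiable G t.
    apply: differentiable_funM; last first.
      rewrite /curve_factor; differentiate1.
      by rewrite expf_neq0 // gt_eqF // curve_den_gt0.
    have := differentiable_comp dgamma (differentiable_prefactor2 ms).
    rewrite (_ : _ \o _ = (fun u => prefactor2 (beta_of u) (alpha_of u))) //.
    by apply/funext => u; rewrite /= !mxE.
  have dG' : is_derive t 1 G ('D_1 G t).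
    by apply: derivableP; exact: diff_derivable.
  (* As [critical_poly] vanishes at t, the derivative of the product is [G t] times
     [critical_deriv t]; the value of the derivative of [G] is irrelevant. *)
  have [_ ->] := is_derive_funM dG' (is_derive_critical t).
  rewrite t0 mul0r addr0; apply: mulf_neq0; last first.
    by rewrite gt_eqF // critical_deriv_gt0.
  apply: mulf_neq0; last exact: curve_factor_neq0.
  exact: (prefactor2_neq0 (beta_of01 t01) (alpha_of_gt0 t01)).
- apply: partial_alpha_l1_neq0 => //; rewrite /S /W !mxE /= curve_W //
  beta_of2 //.
  by rewrite bautin_curve // gt_eqF // curve_den_gt0.
Unshelve. all: by end_near. Qed.

Lemma critical_unique beta alpha t : 0 < beta < 1 -> 0 < alpha ->
  l1 beta alpha = 0 -> l2 beta alpha = 0 -> t_lo R < t < t_hi R ->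
  critical_poly t = 0 -> beta = beta_of t /\ alpha = alpha_of t.
Proof.
move=> b01 a0 L1 L2 t_in T0; have t01 := near_critical01 t_in; have /andP[b0
  b1] := b01.
have b20 : 0 < beta ^+ 2 < 1 by rewrite exprn_gt0 //= expr_lt1 // ltW.
have W0 : 0 < (alpha * beta ^+ 2) ^+ 2 by rewrite exprn_gt0 // mulr_gt0
  ?exprn_gt0.
have P1 : bautin_poly (beta ^+ 2 - 1) ((alpha * beta ^+ 2) ^+ 2) = 0.
  move: L1; rewrite l1E // => /eqP; rewrite mulf_eq0.
  by rewrite (negbTE (prefactor1_neq0 b01 a0)) => /eqP.
have [t' t'01 [UE WE]] := bautin_curveP b20 W0 P1.
have d0 := curve_den_gt0 t'01.
have U : beta ^+ 2 = beta_sq t' by rewrite /beta_sq -UE mulfK // gt_eqF.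
have tt' : t' = t.
  apply: critical_root_unique => //.
  move: L2; rewrite l2E // WE U second_poly_curve ?gt_eqF // => /eqP.
  rewrite -/(curve_factor t') mulf_eq0 (negbTE (prefactor2_neq0 b01 a0)) /=.
  by rewrite mulf_eq0 (negbTE (curve_factor_neq0 t'01)) => /eqP.
have bE : beta = beta_of t.
  by rewrite /beta_of -tt' -U sqrtr_sqr ger0_norm // ltW.
split=> //; rewrite /alpha_of -tt'.
rewrite (_ : _ / _ = alpha ^+ 2) ?sqrtr_sqr ?ger0_norm ?ltW //.
have b2 : beta ^+ 2 != 0 by rewrite expf_neq0 // gt_eqF.
apply: (mulIf b2); rewrite -U divfK //; apply: (mulIf b2).
by rewrite -WE; ring.
Qed.

End Transversality.

Theorem theorem4p3 (R : realType) :
  exists beta alpha : R,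
    [/\ [/\ 0 < beta < 1, 0 < alpha, l1 beta alpha = 0 & l2 beta alpha = 0],
        forall beta' alpha' : R,
          0 < beta' < 1 -> 0 < alpha' ->
          l1 beta' alpha' = 0 -> l2 beta' alpha' = 0 ->
          beta' = beta /\ alpha' = alpha,
        [/\ leading_digits beta 0
              [:: 8; 6; 8; 2; 8; 0; 3; 3; 9; 9; 7; 9; 7; 1; 2; 8; 1; 5; 4; 2]%N,
            leading_digits alpha 0
              [:: 8; 5; 0; 5; 0; 0; 4; 8; 4; 3; 0; 6; 8; 5; 0; 1; 7; 8; 5; 6]%N
          & leading_digits (eps_c beta alpha) 1
              [:: 3; 7; 6; 2; 4; 1; 0; 6; 4; 8; 4; 6; 5; 9; 9; 5; 3; 1; 7; 1]%N]
      & transversal_at (on_plane (@l1 R)) (on_plane (@l2 R))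
          (\col_i [:: beta; alpha]`_i)].
Proof.
have [t t_in T0] := critical_root R; have t01 := near_critical01 t_in.
exists (beta_of t), (alpha_of t); split.
- split; [exact: beta_of01 | exact: alpha_of_gt0 | exact: l1_on_curve |].
  by rewrite l2_on_curve // T0 mulr0.
- by move=> b a b01 a0 L1 L2; exact: critical_unique.
- by split; [exact: beta_digits | exact: alpha_digits | exact: eps_digits].
- exact: transversal_on_curve.
Qed.
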